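(* Let $\{n_\ell\}_{\ell\ge1}$ be a sequence satisfying the standing assumptions stated in the context, and let $f_1,f_2,f_3,f_4$ be the associated power series defined there. Let $\alpha$ be an algebraic integer with $|\alpha|>1$ such that every conjugate of $\alpha$ over $\mathbb{Q}$ other than $\alpha$ itself and its complex conjugate $\overline{\alpha}$ lies in the open unit disk $\{z:|z|<1\}$. Then the five numbers \[ 1,\quad f_1(\alpha^{-1}),\quad f_2(\alpha^{-1}),\quad f_3(\alpha^{-1}),\quad f_4(\alpha^{-1}) \] are linearly independent over the field $\mathbb{Q}(\alpha)$.
   Context: Standing assumptions: $\{n_\ell\}_{\ell\ge1}$ is a strictly increasing sequence of positive odd integers such that (i) any two distinct terms $n_i,n_j$ are coprime, and (ii) $\sum_{\ell=1}^\infty 1/n_\ell<\infty$. For a positive integer $n$, let $a_1(n)$ (resp. $a_3(n)$) be the number of terms $n_\ell$ of the sequence which divide $n$ and satisfy $n_\ell\equiv1\pmod 4$ (resp. $n_\ell\equiv 3\pmod 4$). For $j=1,2,3,4$ define $b_j(n)=a_1(n)$ if $n\equiv j\pmod 4$, $b_j(n)=a_3(n)$ if $n\equiv j+2\pmod 4$, and $b_j(n)=0$ otherwise, and set $f_j(z)=\sum_{n=1}^\infty b_j(n)z^n$, which converges for $|z|<1$. *)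

(* Defs.v *)
From Stdlib Require Import Reals Lra Lia ZArith QArith Qreals Arith List.
Open Scope R_scope.

Record Cx : Type := mkC { re : R; im : R }.

Definition Cx0 : Cx := mkC 0 0.
Definition Cx1 : Cx := mkC 1 0.
Definition RtoC (x : R) : Cx := mkC x 0.
Definition Cadd (z w : Cx) : Cx := mkC (re z + re w) (im z + im w).
Definition Cmul (z w : Cx) : Cx :=
  mkC (re z * re w - im z * im w) (re z * im w + im z * re w).
Definition Cconj (z : Cx) : Cx := mkC (re z) (- im z).
Definition Cnorm (z : Cx) : R := sqrt (re z * re z + im z * im z).
Definition Cinv (z : Cx) : Cx :=
  mkC (re z / (re z * re z + im z * im z)) (- im z / (re z * re z + im z * im z)).
Definition Cdiv (z w : Cx) : Cx := Cmul z (Cinv w).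
Fixpoint Cpow (z : Cx) (k : nat) : Cx :=
  match k with O => Cx1 | S k' => Cmul z (Cpow z k') end.

Fixpoint peval (p : list Cx) (z : Cx) : Cx :=
  match p with nil => Cx0 | a :: p' => Cadd a (Cmul z (peval p' z)) end.
Definition QtoC (q : Q) : Cx := RtoC (Q2R q).
Definition ZtoC (k : Z) : Cx := RtoC (IZR k).
Definition pevalQ (p : list Q) (z : Cx) : Cx := peval (map QtoC p) z.
Definition pevalZ (p : list Z) (z : Cx) : Cx := peval (map ZtoC p) z.

Definition algebraic_integer (a : Cx) : Prop :=
  exists p : list Z, last p 0%Z = 1%Z /\ pevalZ p a = Cx0.

Definition nonzero_polyQ (p : list Q) : Prop := ~ (last p 0%Q == 0)%Q.

Definition minimal_polyQ (p : list Q) (a : Cx) : Prop :=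
  nonzero_polyQ p /\ pevalQ p a = Cx0 /\
  forall q : list Q, nonzero_polyQ q -> pevalQ q a = Cx0 -> (length p <= length q)%nat.

Definition conjugate_over_Q (a z : Cx) : Prop :=
  exists p : list Q, minimal_polyQ p a /\ pevalQ p z = Cx0.

Definition in_Qalpha (a c : Cx) : Prop :=
  exists p q : list Q, pevalQ q a <> Cx0 /\ c = Cdiv (pevalQ p a) (pevalQ q a).

(* The sequence n_1, n_2, ... is represented by s : nat -> nat with
   s 0 = n_1, s 1 = n_2, ...  Since the s i are strictly increasing positive
   integers, s i >= i+1, so only indices i < m can give s i dividing m >= 1. *)
Definition count_div (s : nat -> nat) (r m : nat) : nat :=
  length (filter (fun i => Nat.eqb (m mod (s i)) 0 && Nat.eqb ((s i) mod 4) r)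
                 (seq 0 m)).
Definition a1 (s : nat -> nat) (m : nat) : nat := count_div s 1 m.
Definition a3 (s : nat -> nat) (m : nat) : nat := count_div s 3 m.

Definition b (s : nat -> nat) (j m : nat) : nat :=
  if Nat.eqb (m mod 4) (j mod 4) then a1 s m
  else if Nat.eqb (m mod 4) ((j + 2) mod 4) then a3 s m
  else 0.

Fixpoint fpartial (s : nat -> nat) (j : nat) (z : Cx) (N : nat) : Cx :=
  match N with
  | O => Cmul (RtoC (INR (b s j 1))) z
  | S N' => Cadd (fpartial s j z N')
                 (Cmul (RtoC (INR (b s j (S (S N'))))) (Cpow z (S (S N'))))
  end.

Definition f_sum (s : nat -> nat) (j : nat) (z F : Cx) : Prop :=
  Un_cv (fun N => re (fpartial s j z N)) (re F) /\
  Un_cv (fun N => im (fpartial s j z N)) (im F).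

Definition standing_assumptions (s : nat -> nat) : Prop :=
  (forall i j, (i < j)%nat -> (s i < s j)%nat) /\
  (forall i, (0 < s i)%nat /\ Nat.odd (s i) = true) /\
  (forall i j, i <> j -> Nat.gcd (s i) (s j) = 1%nat) /\
  (exists l : R, Un_cv (fun N => sum_f_R0 (fun i => / INR (s i)) N) l).

(* Main.v *)
(** Suppose c_0 + sum_j c_j f_j(1/alpha) = 0; clearing denominators, c_j = C_j(alpha)
    with C_j in Z[X].  Truncating the series at N and multiplying by alpha^N gives
    A_N(alpha) with A_N in Z[X], and A_N(alpha) = - sum_{k >= 1} beta(N + k) alpha^(-k),
    where beta(n) collects one C_j for each term of the sequence dividing n.

    Fix k_0 and choose M large.  The Chinese remainder theorem, and an averaging over
    arithmetic progressions that uses sum 1/n_l < oo, provide N and N' which agree modulo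
    4 and modulo the first M terms, such that the next term divides N' + k_0, while the
    total weight of all other divisibilities of N + k and N' + k by terms beyond the
    first M, discounted by rho^|k|, is negligible.  Then A_N - A_N' is small at every
    conjugate of alpha inside the unit disk, and close to C_j(alpha) alpha^(-k_0) at alpha.
    The product of its values at all conjugates is an integer of modulus < 1, so
    A_N(alpha) = A_N'(alpha), which forces C_j(alpha) = 0. *)
Require Import Defs.
From Stdlib Require Import Reals QArith Qreals List.
From mathcomp Require Import all_boot all_order all_algebra.
From mathcomp Require Import archimedean zify ssrZ ring lra boolp reals complex Rstruct.

Set Implicit Arguments.
Unset Strict Implicit.
Unset Printing Implicit Defensive.
Import Order.TTheory GRing.Theory Num.Theory.
Local Open Scope ring_scope.

(** * Geometric sums *)

Section GeometricSums.
Variable R : archiRealFieldType.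
Implicit Types (rho eps : R).

Lemma geo_sum_le rho K : 0 <= rho < 1 -> \sum_(k < K) rho ^+ k <= (1 - rho)^-1.
Proof.
move=> /andP[h0 h1]; have h : 0 < 1 - rho by rewrite subr_gt0.
rewrite -(ler_pM2l h) mulfV ?gt_eqF// -opprB mulNr -subrX1 opprB.
by rewrite lerBlDr lerDl exprn_ge0.
Qed.

Lemma geo_tail_le rho (L K : nat) : 0 <= rho < 1 ->
  \sum_(k < K | (L <= k)%N) rho ^+ k <= rho ^+ L / (1 - rho).
Proof.
move=> h; have /andP[h0 h1] := h.
have [KL|LK] := leqP K L.
  rewrite big1 => [|k]; last by have := ltn_ord k; lia.
  by rewrite divr_ge0 ?exprn_ge0 ?subr_ge0 // ltW.
rewrite -(big_mkord (fun k => (L <= k)%N) (fun k => rho ^+ k)).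
rewrite (big_cat_nat _ (ltnW LK)) //= big1_seq ?add0r; last first.
  by move=> k; rewrite mem_index_iota => /andP[]; lia.
rewrite -{1}(add0n L) big_addn big_mkord.
rewrite (eq_bigl xpredT) => [|k]; last by rewrite leq_addl.
under eq_bigr do rewrite exprD mulrC.
by rewrite -mulr_sumr ler_wpM2l ?exprn_ge0 ?geo_sum_le.
Qed.

(** Each of the first [n0] powers is at least [rho ^+ n0], so [n0] times it is at most the geometric
    sum, hence at most [(1 - rho)^-1]; the Archimedean property then supplies [n0]. *)
Lemma expr_small rho eps : 0 <= rho < 1 -> 0 < eps ->
  exists n0, forall n, (n0 <= n)%N -> rho ^+ n < eps.
Proof.
move=> h e0; have /andP[h0 h1] := h.
have h' : 0 < 1 - rho by rewrite subr_gt0.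
pose n0 := (Num.bound (eps^-1 / (1 - rho))).+1.
exists n0 => n hn.
apply: (@le_lt_trans _ _ (rho ^+ n0)).
  by apply: ler_wiXn2l => //; exact: ltW.
have : rho ^+ n0 *+ n0 <= (1 - rho)^-1.
  apply: le_trans (geo_sum_le n0 h).
  rewrite -[X in _ *+ X]card_ord -sumr_const ler_sum// => i _.
  by apply: ler_wiXn2l => //; [exact: ltW | exact: (ltnW (ltn_ord i))].
have : eps^-1 / (1 - rho) < n0%:R.
  apply: (lt_trans (archi_boundP _)); last by rewrite ltr_nat.
  by rewrite mulr_ge0// ?invr_ge0 ltW.
rewrite ltr_pdivrMr// => h2; rewrite -[_ *+ n0]mulr_natr => h3.
have n0p : 0 < n0%:R :> R by rewrite ltr0n.
rewrite -(ltr_pM2r n0p); apply: le_lt_trans h3 _.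
rewrite -(ltr_pM2r h') mulVf ?gt_eqF// -mulrA -ltr_pdivrMl// mulr1; exact: h2.
Qed.

(** Write [k] as the number of [l < k] and exchange the sums: each inner sum is a geometric tail. *)
Lemma linear_geo_sum_le rho K : 0 <= rho < 1 ->
  \sum_(k < K) rho ^+ k * k%:R <= (1 - rho)^-1 / (1 - rho).
Proof.
move=> h; have /andP[h0 h1] := h.
have h' : 0 < 1 - rho by rewrite subr_gt0.
have -> : \sum_(k < K) rho ^+ k * k%:R =
    \sum_(l < K) \sum_(k < K | (l < k)%N) rho ^+ k.
  rewrite (exchange_big_dep xpredT) //=; apply: eq_bigr => k _.
  rewrite sumr_const mulr_natr; congr (_ *+ _).
  rewrite -[LHS](card_ord k) -!sum1_card.
  rewrite (big_ord_widen K (fun=> 1%N)) ?(ltnW (ltn_ord k))//.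
apply: (@le_trans _ _ (\sum_(l < K) rho ^+ l / (1 - rho))).
  apply: ler_sum => l _.
  apply: le_trans (geo_tail_le _ _ h) _.
  rewrite ler_wpM2r ?invr_ge0 ?(ltW h')// exprS.
  by rewrite ler_piMl ?exprn_ge0// ltW.
by rewrite -mulr_suml ler_wpM2r ?geo_sum_le// invr_ge0 ltW.
Qed.

End GeometricSums.

(** * Averaging the number of divisors over a progression *)

Section Averaging.
Variable R : archiRealFieldType.
Variable s : nat -> nat.
Hypothesis s_gt : forall i, (i < s i)%N.
Hypothesis s_tail : forall eps : R, 0 < eps ->
  exists M, forall L, \sum_(M <= i < L) (s i)%:R^-1 <= eps.

(** For [n > 0] the cut at [i < n] loses nothing, since [s i > i]. At [n = 0] the sum is empty, so a
    truncated difference [N - k = 0] counts no divisor. *)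
Definition ndiv (M n : nat) : nat := \sum_(M <= i < n) (s i %| n).

(** Two points of [P] never share a block of length [n], so [t %/ n] is injective on [P]. *)
Lemma count_separated_le (P : pred nat) n T : (0 < n)%N ->
  (forall t t', (t < t')%N -> P t -> P t' -> n %| t' - t)%N ->
  (\sum_(t < T) P t <= T %/ n + 1)%N.
Proof.
move=> n0 hP.
rewrite -big_mkcond sum1_card addn1 -[X in (_ <= X)%N]card_ord.
pose f (t : 'I_T) : 'I_(T %/ n).+1 := inord (t %/ n).
have fE (t : 'I_T) : f t = (t %/ n)%N :> nat.
  by rewrite inordK// ltnS leq_div2r// ltnW.
apply: (@leq_card_in _ _ f) => t t'; rewrite !unfold_in => Pt Pt' /(congr1 val).
rewrite /= !fE => e; apply/val_inj => /=.
wlog lt_tt' : t t' Pt Pt' e / (t < t')%N.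
  move=> hw; case: (ltngtP t t') => // h; first exact: (hw t t').
  by apply/esym; apply: (hw t' t).
have : (n <= t' - t)%N by apply: dvdn_leq (hP _ _ lt_tt' Pt Pt'); rewrite subn_gt0.
have := divn_eq t n; have := divn_eq t' n; rewrite e.
have := ltn_pmod t' n0; move: (t' %/ n * n)%N; lia.
Qed.

(** An index from [l0] on with [s i <= Y] costs at most [Y / s i]; the others cost at most [l0]. For
    small [kappa] the terms are thus sparse, which absorbs the [+ 1] of [count_separated_le]. *)
Lemma few_terms_le (l0 Y : nat) (kappa : R) :
  (forall L, \sum_(l0 <= i < L) (s i)%:R^-1 <= kappa) ->
  \sum_(0 <= i < Y) (s i <= Y)%N%:R <= l0%:R + Y%:R * kappa.
Proof.
move=> hk.
apply: (@le_trans _ _ (\sum_(0 <= i < Y) ((i < l0)%N%:R +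
    (if (l0 <= i)%N then Y%:R * (s i)%:R^-1 else 0)))).
  apply: ler_sum => i _; rewrite leqNgt; case: (ltnP i l0) => /= h.
    by rewrite addr0 ler_nat leq_b1.
  rewrite add0r; case: ltnP => /= h1; first by rewrite mulr_ge0 ?invr_ge0 ?ler0n.
  have p : 0 < (s i)%:R :> R by rewrite ltr0n (leq_trans _ (s_gt i)).
  by rewrite ler_pdivlMr// mul1r ler_nat.
rewrite big_split /=; apply: lerD.
  rewrite -natr_sum ler_nat -big_mkcond /= big_mkord sum1_card.
  rewrite -[X in (_ <= X)%N]card_ord.
  case: l0 {hk} => [|l0]; first by rewrite (eq_card0 (fun=> erefl)).
  apply: (@leq_card_in _ _ (fun i : 'I_Y => inord i : 'I_l0.+1)).
  move=> i j; rewrite !unfold_in => hi hj /(congr1 val) /=.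
  by rewrite !inordK// => e; apply: val_inj.
rewrite -big_mkcond /=.
apply: (@le_trans _ _ (Y%:R * \sum_(l0 <= i < Y) (s i)%:R^-1)); last first.
  by rewrite ler_wpM2l ?ler0n.
rewrite mulr_sumr; have [h|h] := leqP l0 Y.
  rewrite (big_cat_nat _ h)//= big1_seq ?add0r; last first.
    by move=> k; rewrite mem_index_iota => /andP[]; lia.
  rewrite big_seq_cond [X in _ <= X]big_seq_cond le_eqVlt; apply/orP; left; apply/eqP.
  by apply: eq_bigl => i; rewrite mem_index_iota; lia.
rewrite big1_seq; first by apply: sumr_ge0 => i _; rewrite mulr_ge0// invr_ge0.
by move=> k; rewrite mem_index_iota => /andP[]; lia.
Qed.

(** Exchange the sums: one [s i] divides at most [T %/ s i + 1] of the positive values [m t]. The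
    quotients add up to at most [T * eps]; the ones occur only for [s i <= Y], where [few_terms_le]
    counts them. *)
Lemma sum_ndiv_le (M l0 T Y : nat) (m : nat -> nat) (eps kappa : R) :
  (forall L, \sum_(M <= i < L) (s i)%:R^-1 <= eps) ->
  (forall L, \sum_(l0 <= i < L) (s i)%:R^-1 <= kappa) ->
  (forall t, (t < T)%N -> (m t <= Y)%N) ->
  (forall i t t', (M <= i)%N -> (t < t')%N -> (0 < m t)%N -> (0 < m t')%N ->
     (s i %| m t)%N -> (s i %| m t')%N -> (s i %| t' - t)%N) ->
  (\sum_(t < T) ndiv M (m t))%:R <= T%:R * eps + (l0%:R + Y%:R * kappa).
Proof.
move=> he hk hY hsep.
have s0 i : (0 < s i)%N by rewrite (leq_trans _ (s_gt i)).
have : (\sum_(t < T) ndiv M (m t) <=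
    \sum_(M <= i < Y) (s i <= Y) * (T %/ s i + 1))%N.
  apply: (@leq_trans (\sum_(t < T) \sum_(M <= i < Y)
     ((0 < m t) && (s i %| m t)))%N).
    apply: leq_sum => t _; rewrite /ndiv.
    have [h|h] := leqP M (m t); last by rewrite big_geq// ltnW.
    rewrite [X in (_ <= X)%N](big_cat_nat h)/=; last exact: hY.
    apply: leq_trans (leq_addr _ _).
    rewrite big_seq [X in (_ <= X)%N]big_seq; apply: leq_sum => i.
    by rewrite mem_index_iota => /andP[h1 h2]; rewrite (leq_trans _ h2).
  rewrite exchange_big /= big_seq [X in (_ <= X)%N]big_seq.
  apply: leq_sum => i; rewrite mem_index_iota => /andP[h1 h2].
  case: (leqP (s i) Y) => h /=; rewrite ?mul1n ?mul0n.
    apply: (@count_separated_le (fun t => (0 < m t) && (s i %| m t))%N) => //.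
    by move=> t t' tt' /andP[? ?] /andP[? ?]; apply: (hsep i).
  rewrite leqn0 sum_nat_eq0; apply/forallP => t /=; rewrite eqb0.
  apply/negP => /andP[h3 h4]; have := dvdn_leq h3 h4.
  by have := hY t (ltn_ord t); lia.
rewrite -(ler_nat R) => /le_trans; apply; rewrite natr_sum.
apply: (@le_trans _ _ (\sum_(M <= i < Y) (T%:R * (s i)%:R^-1 + (s i <= Y)%N%:R))).
  apply: ler_sum => i _; case: (leqP (s i) Y) => h /=; rewrite ?mul1n ?mul0n.
    rewrite natrD lerD2r ler_pdivlMr ?ltr0n// -natrM ler_nat.
    exact: leq_trunc_div.
  by rewrite addr0 mulr_ge0 ?invr_ge0.
rewrite big_split /= -mulr_sumr; apply: lerD; first by rewrite ler_wpM2l.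
apply: le_trans (few_terms_le _ hk).
have [h|h] := leqP M Y; last by rewrite big_geq ?sumr_ge0// ltnW.
by rewrite [X in _ <= X](big_cat_nat _ h)//= lerDr sumr_ge0.
Qed.

(** The forward part [N + k] governs the tail of the series at alpha, the backward part [N - k] the
    values at the conjugates inside the unit disk. *)
Definition wdiv (rho : R) (M N K : nat) : R :=
  \sum_(k < K) rho ^+ k * (ndiv M (N + k) + ndiv M (N - k))%:R.

Lemma exists_uniform_bound (f : nat -> nat -> R) (T : nat) (B : R) :
  (forall t, {homo f t : k k' / (k <= k')%N >-> k <= k'}) ->
  (forall t, (t < T)%N -> exists K, B < f t K) ->
  exists K, forall t, (t < T)%N -> B < f t K.
Proof.
move=> hm; elim: T => [|T IH] h; first by exists 0%N.
have [|K1 h1] := IH; first by move=> t ht; apply: h; rewrite ltnW.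
have [K2 h2] := h T (ltnSn T).
exists (maxn K1 K2) => t; rewrite ltnS leq_eqVlt => /orP[/eqP ->|ht].
  by apply: (lt_le_trans h2); apply: hm; rewrite leq_maxr.
by apply: (lt_le_trans (h1 _ ht)); apply: hm; rewrite leq_maxl.
Qed.

(** If every [N] of the progression failed, one common [K] would push the mean of [wdiv] over its
    first [T] members above the bound, whereas exchanging the sums and [sum_ndiv_le] keep that mean
    below it. *)
Lemma average_wdiv (rho eps : R) (M Q r N0 : nat) :
  0 <= rho < 1 -> 0 < eps -> (0 < Q)%N ->
  (forall L, \sum_(M <= i < L) (s i)%:R^-1 <= eps) ->
  (forall i, (M <= i)%N -> coprime (s i) Q) ->
  exists N, [/\ (N0 <= N)%N, N = r %[mod Q] &
    forall K, wdiv rho M N K <= 5 * eps / (1 - rho)].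
Proof.
move=> h e0 Q0 he hco; have /andP[h0 h1] := h.
have h' : 0 < 1 - rho by rewrite subr_gt0.
have Q0' : 0 < Q%:R :> R by rewrite ltr0n.
(* With [kappa = eps / Q], the terms up to a height of order [Q * T] number at most [T * eps], apart
   from a quantity independent of [T]. *)
have [l0 hl0] := s_tail (divr_gt0 e0 Q0').
have [a aE] : exists a, a = (r + Q * N0)%N by exists (r + Q * N0)%N.
(* [c] gathers all contributions that do not grow with [T]. For [T] large it costs one more
   [T * eps] on top of the four main ones, whence the factor 5. *)
pose c : R := 2 * (l0%:R + a%:R * eps) + 2 * eps / (1 - rho).
have c0 : 0 <= c.
  apply: addr_ge0; last by rewrite divr_ge0 ?mulr_ge0 ?(ltW e0) ?(ltW h').
  by rewrite mulr_ge0 ?addr_ge0 ?mulr_ge0 ?(ltW e0).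
have [T [T0 hT]] : exists T, (0 < T)%N /\ c <= T%:R * eps.
  exists (Num.bound (c / eps)).+1; split=> //; rewrite -ler_pdivrMr//; apply: ltW.
  apply: (lt_trans (archi_boundP _)); last by rewrite ltr_nat.
  by rewrite divr_ge0// ltW.
pose N t := (a + Q * t)%N.
have kap k t : (t <= T)%N ->
   (a + Q * t + k)%:R * (eps / Q%:R) <= a%:R * eps + T%:R * eps + k%:R * eps.
  move=> ht.
  have e1 : eps / Q%:R <= eps by rewrite ler_pdivrMr// ler_peMr ?(ltW e0) ?ler1n.
  rewrite !natrD !mulrDl; apply: lerD; first apply: lerD.
  - by rewrite ler_wpM2l.
  - have -> : (Q * t)%:R * (eps / Q%:R) = t%:R * eps.
      by rewrite natrM; field; rewrite gt_eqF.
    by rewrite ler_wpM2r ?ler_nat ?(ltW e0).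
  - by rewrite ler_wpM2l.
have step k : (\sum_(t < T) (ndiv M (N t + k) + ndiv M (N t - k)))%:R <=
    4 * (T%:R * eps) + 2 * (l0%:R + a%:R * eps) + 2 * eps * k%:R.
  rewrite big_split natrD /=.
  have hdvd i t t' : (M <= i)%N -> (s i %| Q * (t' - t))%N -> (s i %| t' - t)%N.
    by move=> hi; rewrite Gauss_dvdr// hco.
  have b1 : (\sum_(t < T) ndiv M (N t + k))%:R <=
     T%:R * eps + (l0%:R + (a + Q * T + k)%:R * (eps / Q%:R)).
    apply: (@sum_ndiv_le _ _ _ _ (fun t => N t + k)%N) => //.
      move=> t /ltnW tT; rewrite leq_add2r leq_add2l.
      by rewrite leq_mul2l tT orbT.
    move=> i t t' Mi tt' _ _ d1 d2; apply: hdvd => //.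
    have -> : (Q * (t' - t) = N t' + k - (N t + k))%N by rewrite /N; nia.
    exact: dvdn_sub.
  have b2 : (\sum_(t < T) ndiv M (N t - k))%:R <=
     T%:R * eps + (l0%:R + (a + Q * T + k)%:R * (eps / Q%:R)).
    apply: (@sum_ndiv_le _ _ _ _ (fun t => N t - k)%N) => //.
      by move=> t /ltnW tT; rewrite /N; nia.
    move=> i t t' Mi tt' p1 p2 d1 d2; apply: hdvd => //.
    have -> : (Q * (t' - t) = N t' - k - (N t - k))%N by move: p1 p2; rewrite /N; nia.
    exact: dvdn_sub.
  have := kap k T (leqnn _); lra.
suff [t [tT ht]] : exists t, (t < T)%N /\
    forall K, wdiv rho M (N t) K <= 5 * eps / (1 - rho).
  exists (N t); split => //; last by rewrite /N aE -addnA -mulnDr addnC mulnC modnMDl.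
  by rewrite /N aE -addnA; nia.
apply: contrapT => /forallNP hno.
have [||K hK] := @exists_uniform_bound (fun t => wdiv rho M (N t)) T (5 * eps / (1 - rho)).
- move=> t K K' KK'; rewrite /wdiv -!(big_mkord xpredT
    (fun k => rho ^+ k * (ndiv M (N t + k) + ndiv M (N t - k))%:R)).
  rewrite [X in _ <= X](big_cat_nat _ KK')//= lerDl sumr_ge0// => k _.
  by rewrite mulr_ge0 ?exprn_ge0.
- move=> t tT; have /not_andP[//|/existsNP[K /negP]] := hno t.
  by rewrite -ltNge; exists K.
have : \sum_(t < T) (5 * eps / (1 - rho)) < \sum_(t < T) wdiv rho M (N t) K.
  apply: ltr_sum => [|t _]; last exact: hK.
  by apply/hasP; exists (Ordinal T0); rewrite ?mem_index_enum.
rewrite sumr_const card_ord -[_ *+ T]mulr_natr /wdiv exchange_big /= ltNge => /negP; apply.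
under eq_bigr do rewrite -mulr_sumr -natr_sum.
apply: (@le_trans _ _ (\sum_(k < K) (rho ^+ k * (4 * (T%:R * eps) +
    2 * (l0%:R + a%:R * eps)) + 2 * eps * (rho ^+ k * k%:R)))).
  apply: ler_sum => k _.
  rewrite [X in _ <= _ + X]mulrCA -mulrDr ler_wpM2l ?exprn_ge0//; exact: step.
rewrite big_split /= -mulr_suml -mulr_sumr.
have g1 := geo_sum_le K h; have g2 := linear_geo_sum_le K h.
apply: (@le_trans _ _ ((1 - rho)^-1 * (4 * (T%:R * eps) + 2 * (l0%:R + a%:R * eps)) +
    2 * eps * ((1 - rho)^-1 / (1 - rho)))).
  apply: lerD; first rewrite ler_wpM2r//.
    by rewrite !addr_ge0 ?mulr_ge0 ?addr_ge0 ?mulr_ge0 ?(ltW e0).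
  by rewrite ler_wpM2l// mulr_ge0// ltW.
have -> : 2 * eps * ((1 - rho)^-1 / (1 - rho)) = (1 - rho)^-1 * (2 * eps / (1 - rho)).
  by ring.
rewrite -mulrDr -addrA -/c mulrAC [X in _ <= X]mulrC.
rewrite ler_wpM2l ?invr_ge0 ?(ltW h')//.
by move: hT; lra.
Qed.
End Averaging.

(** * Pairs of indices *)

Section ClosePairs.
Variable R : archiRealFieldType.
Variable s : nat -> nat.
Hypothesis s_gt : forall i, (i < s i)%N.
Hypothesis s_odd : forall i, odd (s i).
Hypothesis s_coprime : forall i j, i != j -> coprime (s i) (s j).
Hypothesis s_tail : forall eps : R, 0 < eps ->
  exists M, forall L, \sum_(M <= i < L) (s i)%:R^-1 <= eps.

Lemma tail_mono (M M' : nat) (eps : R) : (M <= M')%N ->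
  (forall L, \sum_(M <= i < L) (s i)%:R^-1 <= eps) ->
  forall L, \sum_(M' <= i < L) (s i)%:R^-1 <= eps.
Proof.
move=> MM' h L; apply: le_trans (h L).
have [l|l] := leqP M' L.
  by rewrite [X in _ <= X](big_cat_nat MM' l)/= lerDr sumr_ge0// => i _; rewrite invr_ge0.
by rewrite big_geq ?(ltnW l)// sumr_ge0// => i _; rewrite invr_ge0.
Qed.

Lemma ndiv_recl M n : ndiv s M n = ((M < n) && (s M %| n) + ndiv s M.+1 n)%N.
Proof.
rewrite /ndiv; case: ltnP => h; first by rewrite big_ltn.
by rewrite !big_geq// leqW.
Qed.

(** Leaves out the one intended divisibility, that of [N + k0] by [s M]. *)
Definition wdiv_except (rho : R) (M k0 N K : nat) : R :=
  \sum_(k < K) rho ^+ k *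
    ((if k == k0 :> nat then ndiv s M.+1 (N + k) else ndiv s M (N + k))
     + ndiv s M (N - k))%:R.

(** Distinct multiples of [s M] are at least [s M] apart, so any other multiple [N + k] or [N - k]
    has [k >= s M - k0]. These contribute at most two geometric tails. *)
Lemma wdiv_except_le (rho : R) (M k0 N K : nat) : 0 <= rho < 1 -> (0 < k0)%N ->
  (s M %| N + k0)%N ->
  wdiv_except rho M k0 N K <=
    wdiv s rho M.+1 N K + 2 * (rho ^+ (s M - k0) / (1 - rho)).
Proof.
move=> h k00 dM; have /andP[h0 h1] := h.
apply: (@le_trans _ _ (wdiv s rho M.+1 N K +
    2 * \sum_(k < K | (s M - k0 <= k)%N) rho ^+ k)); last first.
  by rewrite lerD2l ler_wpM2l// geo_tail_le.
rewrite [X in 2 * X]big_mkcond mulr_sumr -big_split /=; apply: ler_sum => k _.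
have -> : 2 * (if (s M - k0 <= k)%N then rho ^+ k else 0) =
    rho ^+ k * (2 * (s M - k0 <= k)%N)%:R.
  by case: ifP => _; rewrite ?mulr0// natrM mulr1 mulrC.
rewrite -mulrDr -natrD ler_wpM2l ?exprn_ge0// ler_nat.
have e1 : ((M < N - k) && (s M %| N - k) <= (s M - k0 <= k))%N.
  case: (boolP (_ && _)) => // /andP[a1 a2]; rewrite lt0b.
  have : (s M %| (N + k0) - (N - k))%N by exact: dvdn_sub.
  have -> : (N + k0 - (N - k) = k + k0)%N by lia.
  by move/dvdn_leq; rewrite leq_subLR addnC; apply; lia.
have e2 : k != k0 :> nat -> ((M < N + k) && (s M %| N + k) <= (s M - k0 <= k))%N.
  move=> kk; case: (boolP (_ && _)) => // /andP[a1 a2]; rewrite lt0b.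
  have [l|l] := leqP k k0.
    have : (s M %| (N + k0) - (N + k))%N by exact: dvdn_sub.
    by rewrite subnDl => /dvdn_leq; lia.
  have : (s M %| (N + k) - (N + k0))%N by exact: dvdn_sub.
  by rewrite subnDl => /dvdn_leq; lia.
rewrite (ndiv_recl M (N - k)).
have aux (x y t : bool) (p q : nat) : (x <= t -> y <= t ->
    (x + p) + (y + q) <= p + q + 2 * t)%N.
  by clear; case: x; case: y; case: t => //= _ _; lia.
case: eqP => [_|/eqP /e2 {}e2]; last by rewrite (ndiv_recl M (N + k)); apply: aux.
exact: (aux false).
Qed.

(** The Chinese remainder theorem prescribes the residues and [average_wdiv] finds sparse [N] and
    [N'] in them. The residue modulo 4 is a function [g] because [M], and with it the class of
    [s M], is chosen inside the proof. *)
Lemma close_pair (rho delta : R) (k0 : nat) (g : nat -> nat) :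
  0 <= rho < 1 -> 0 < delta -> (0 < k0)%N ->
  exists M N N', [/\ N = N' %[mod 4], forall i, (i < M)%N -> N = N' %[mod s i],
      (s M %| N' + k0)%N & (N' + k0)%N = g M %[mod 4]] /\
    [/\ (M < N')%N, forall K, wdiv s rho M N K <= delta,
        forall K, wdiv_except rho M k0 N' K <= delta &
        forall n, (minn N N' <= n)%N -> 
          rho ^+ n <= delta /\ M%:R * rho ^+ n / (1 - rho) <= delta].
Proof.
move=> h d0 k00; have /andP[h0 h1] := h.
have h' : 0 < 1 - rho by rewrite subr_gt0.
(* The factor 20 turns the bound [5 * eps / (1 - rho)] into [delta / 4]. *)
pose eps := delta * (1 - rho) / 20.
have e0 : 0 < eps by rewrite divr_gt0// mulr_gt0.
have [M0 hM0] := s_tail e0.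
have [|n1 hn1] := @expr_small R rho (delta * (1 - rho) / 4) h.
  by rewrite divr_gt0// mulr_gt0.
(* Since [s M > M], this gives [s M - k0 >= n1], which makes the tail in [wdiv_except_le] small. *)
pose M := maxn M0 (n1 + k0).
have hM : forall L, \sum_(M <= i < L) (s i)%:R^-1 <= eps.
  by apply: tail_mono hM0; rewrite leq_maxl.
have hM1 : forall L, \sum_(M.+1 <= i < L) (s i)%:R^-1 <= eps.
  by apply: tail_mono hM.
pose Q := (4 * \prod_(i < M) s i)%N.
have s0 i : (0 < s i)%N by rewrite (leq_trans _ (s_gt i)).
have Q0 : (0 < Q)%N by rewrite muln_gt0 /= prodn_gt0.
have cQ i : (M <= i)%N -> coprime (s i) Q.
  move=> hi; rewrite coprimeMr; apply/andP; split.
    by rewrite (coprimeXr 2 (n := 2)) // coprimen2 s_odd.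
  apply: (big_ind (fun x => coprime (s i) x)).
  - by rewrite coprimen1.
  - by move=> x y hx hy; rewrite coprimeMr hx.
  - by move=> j _; apply: s_coprime; have := ltn_ord j; lia.
(* [tau] depends on [M], so the lower bound [N0] for [N] and [N'] can only be set now; it yields
   both estimates of the last clause. *)
pose tau := Num.min delta (delta * (1 - rho) / M.+1%:R).
have t0 : 0 < tau by rewrite lt_min d0 divr_gt0// mulr_gt0.
have [n2 hn2] := expr_small h t0.
pose N0 := maxn n2 M.+1.
have [N [hN1 hN2 hN3]] := @average_wdiv R s s_gt s_tail rho eps M Q
  (g M + 3 * k0) N0 h e0 Q0 hM cQ.
have cQM : coprime Q (s M) by rewrite coprime_sym cQ.
(* Residues without subtraction: [3 * k0] stands for [- k0] modulo 4, and [(s M).-1 * k0] for [- k0]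
   modulo [s M]. *)
pose r' := chinese Q (s M) (g M + 3 * k0) ((s M).-1 * k0).
have [||N' [hN1' hN2' hN3']] := @average_wdiv R s s_gt s_tail rho eps M.+1 (Q * s M)
  r' N0 h e0 _ hM1.
  - by rewrite muln_gt0 Q0 s0.
  - move=> i hi; by rewrite coprimeMr cQ ?s_coprime ?gtn_eqF// ltnW.
have e5 : 5 * eps / (1 - rho) = delta / 4 by rewrite /eps; field; rewrite gt_eqF.
rewrite e5 in hN3 hN3'.
have NN' : N' = g M + 3 * k0 %[mod Q].
  rewrite -(chinese_modl cQM (g M + 3 * k0) ((s M).-1 * k0)) -/r'.
  by rewrite -(modn_dvdm N' (dvdn_mulr (s M) (dvdnn Q))) hN2' modn_dvdm// dvdn_mulr.
have NsM : N' = (s M).-1 * k0 %[mod s M].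
  rewrite -(chinese_modr cQM (g M + 3 * k0) ((s M).-1 * k0)) -/r'.
  by rewrite -(modn_dvdm N' (dvdn_mull Q (dvdnn (s M)))) hN2' modn_dvdm// dvdn_mull.
have Qmod d : (d %| Q)%N -> N = N' %[mod d].
  by move=> dQ; rewrite -(modn_dvdm N dQ) -(modn_dvdm N' dQ) hN2 NN'.
have dM : (s M %| N' + k0)%N.
  rewrite /dvdn -modnDml NsM modnDml -mulSnr prednK//.
  by rewrite modnMr.
exists M, N, N'; split; split.
- by apply: Qmod; rewrite dvdn_mulr.
- move=> i hi; apply: Qmod; rewrite dvdn_mull//.
  by rewrite (bigD1 (Ordinal hi))//= dvdn_mulr.
- exact: dM.
- have d4 : (4 %| Q)%N by rewrite dvdn_mulr.
  rewrite -modnDml -(modn_dvdm N' d4) NN' modn_dvdm// modnDml.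
  by rewrite -addnA -mulSnr mulnC addnC modnMDl.
- by rewrite (leq_trans _ hN1')// leq_maxr.
- by move=> K; apply: le_trans (hN3 K) _; lra.
- move=> K; apply: le_trans (wdiv_except_le _ h k00 dM) _.
  have := hN3' K; have : rho ^+ (s M - k0) / (1 - rho) <= delta / 4; last by lra.
  rewrite ler_pdivrMr// mulrAC; apply/ltW/hn1.
  by rewrite -(addnK k0 n1) leq_sub2r// (leq_trans (leq_maxr M0 _) (ltnW (s_gt M))).
- move=> n hn; have : rho ^+ n < tau.
    apply: hn2; apply: leq_trans (leq_maxl n2 M.+1) (leq_trans _ hn).
    by rewrite leq_min hN1 hN1'.
  rewrite lt_min => /andP[/ltW l1 l2]; split => //.
  rewrite ler_pdivrMr// mulrC; move: l2; rewrite ltr_pdivlMr// => /ltW.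
  by apply: le_trans; rewrite ler_wpM2l ?exprn_ge0// ler_nat.
Qed.
End ClosePairs.

(** * Estimates *)

Section Estimates.
Variable R : realType.
Local Notation C := R[i].
Local Notation nm := (@ComplexField.Normc.normc R).

Lemma normc_ge0 (x : C) : 0 <= nm x.
Proof. by case: x => a b; rewrite sqrtr_ge0. Qed.

Lemma normc_sum (I : Type) (r : seq I) (P : pred I) (F : I -> C) :
  nm (\sum_(i <- r | P i) F i) <= \sum_(i <- r | P i) nm (F i).
Proof.
elim/big_rec2: _ => [|i y x _ h]; first by rewrite ComplexField.Normc.normc0.
by apply: le_trans (le_normcD _ _) _; rewrite lerD2l.
Qed.

Lemma normcX (x : C) n : nm (x ^+ n) = nm x ^+ n.
Proof.
elim: n => [|n IH]; first by rewrite !expr0 ComplexField.Normc.normc1.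
by rewrite !exprS ComplexField.Normc.normcM IH.
Qed.

Lemma normcB (x y : C) : nm (x - y) <= nm x + nm y.
Proof. by apply: le_trans (le_normcD _ _) _; rewrite normcN. Qed.

Variable s : nat -> nat.
Hypothesis s_gt : forall i, (i < s i)%N.
Variables (w : nat -> nat -> C) (B : R).
Hypothesis w_mod : forall i n n', n = n' %[mod 4] -> w i n = w i n'.
Hypothesis w_le : forall i n, nm (w i n) <= B.

Definition term i n : C := if (s i %| n)%N then w i n else 0.
Definition beta n : C := \sum_(0 <= i < n) term i n.

(** This is [z ^+ n] times the series in [1 / z] truncated at [n], with constant term [gam]; the
    recursive form also makes sense at [z = 0]. *)
Fixpoint horner_seq (gam z : C) n : C :=
  if n is n'.+1 then z * horner_seq gam z n' + beta n else gam.

Lemma bound_ge0 : 0 <= B.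
Proof. exact: le_trans (normc_ge0 _) (w_le 0 0). Qed.

Lemma term_le i n : nm (term i n) <= B * (s i %| n)%:R.
Proof.
rewrite /term; case: ifP => _; first by rewrite mulr1.
by rewrite mulr0 ComplexField.Normc.normc0.
Qed.

Lemma beta0 : beta 0 = 0.
Proof. by rewrite /beta big_geq. Qed.

(** The low part runs over all [i < M] even if [M > n]: for [i >= n > 0], [s i > n] cannot divide
    [n]. Hence it depends only on residues of [n]. *)
Lemma beta_split M n : (0 < n)%N ->
  beta n = \sum_(0 <= i < M) term i n + \sum_(M <= i < n) term i n.
Proof.
move=> n0; rewrite /beta; have [h|h] := leqP M n; first by rewrite -big_cat_nat.
rewrite [in RHS](big_cat_nat (leq0n n) (ltnW h)) /= [X in _ + X]big_geq ?(ltnW h)//.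
rewrite addr0 [X in _ + X]big1_seq ?addr0// => i.
rewrite mem_index_iota => /= /andP[h1 h2]; rewrite /term; case: ifP => // d.
by have := dvdn_leq n0 d; have := s_gt i; lia.
Qed.

Lemma high_le M n : nm (\sum_(M <= i < n) term i n) <= B * (ndiv s M n)%:R.
Proof.
apply: le_trans (normc_sum _ _ _) _.
rewrite /ndiv natr_sum mulr_sumr; apply: ler_sum => i _; exact: term_le.
Qed.

Lemma low_le M n : nm (\sum_(0 <= i < M) term i n) <= B * M%:R.
Proof.
apply: le_trans (normc_sum _ _ _) _.
rewrite -[in X in _ <= X](subn0 M) mulr_natr -sumr_const_nat; apply: ler_sum => i _.
apply: le_trans (term_le _ _) _.
by rewrite ler_piMr ?bound_ge0// lern1 leq_b1.
Qed.

(** Any [K >= n] is allowed because [beta 0 = 0]; [N] and [N'] can then be compared over a common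
    range. *)
Lemma horner_seqE gam z n K : (n <= K)%N ->
  horner_seq gam z n = gam * z ^+ n + \sum_(k < K) beta (n - k) * z ^+ k.
Proof.
move=> nK.
rewrite -(big_mkord xpredT (fun k => beta (n - k) * z ^+ k)).
rewrite (big_cat_nat (leq0n n) nK) /= [X in _ + (_ + X)]big1_seq ?addr0; last first.
  move=> k; rewrite mem_index_iota => /= /andP[h _].
  by rewrite (eqP (h : _ - _ == 0)%N) beta0 mul0r.
rewrite big_mkord; elim: n {nK} => [|n IH] /=; first by rewrite big_ord0 addr0 mulr1.
rewrite IH big_ord_recl /= subn0 mulr1 mulrDr mulrCA -exprS -addrA; congr (_ + _).
rewrite addrC; congr (_ + _); rewrite mulr_sumr; apply: eq_bigr => k _.
by rewrite /bump /= subSS mulrCA -exprS.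
Qed.

(** Unrolls the recursion [K] steps forward. Once the boundary term tends to 0, the value at [N] is
    minus the tail of the series beyond [N]. *)
Lemma horner_seq_shift gam z u N K : z * u = 1 ->
  horner_seq gam z N = u ^+ K * horner_seq gam z (N + K)
     - \sum_(k < K.+1 | (0 < k)%N) beta (N + k) * u ^+ k.
Proof.
move=> zu; elim: K => [|K IH].
  by rewrite addn0 mul1r big_mkcond big_ord_recl /= big_ord0 addr0 subr0.
rewrite IH big_mkcond [in RHS]big_mkcond [in RHS]big_ord_recr /= addnS /=.
rewrite mulrDr opprD addrA exprS.
have -> : u * u ^+ K * (z * horner_seq gam z (N + K)) =
   u ^+ K * horner_seq gam z (N + K) by rewrite mulrACA [u * z]mulrC zu mul1r.
by ring.
Qed.

Variables (rho delta : R) (k0 M N N' : nat).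
Hypothesis rho01 : 0 <= rho < 1.
Hypothesis k0_gt0 : (0 < k0)%N.
Hypothesis NN4 : N = N' %[mod 4].
Hypothesis NNs : forall i, (i < M)%N -> N = N' %[mod s i].
Hypothesis wN : forall K, wdiv s rho M N K <= delta.
Hypothesis wN' : forall K, wdiv_except s rho M k0 N' K <= delta.

Lemma term_congr i n n' : n = n' %[mod 4] -> n = n' %[mod s i] ->
  term i n = term i n'.
Proof. by move=> h4 hs; rewrite /term /dvdn hs (w_mod _ h4). Qed.

Lemma modB_congr d n n' k : (k <= n)%N -> (k <= n')%N -> n = n' %[mod d] ->
  (n - k)%N = (n' - k)%N %[mod d].
Proof.
by move=> h h' e; apply/eqP; rewrite -(eqn_modDr k) !subnK//; apply/eqP.
Qed.

Lemma modD_congr d n n' k : n = n' %[mod d] -> (n + k)%N = (n' + k)%N %[mod d].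
Proof. by move=> e; apply/eqP; rewrite eqn_modDr; apply/eqP. Qed.

(** Common final estimate for the inner and outer cases: the weights at [N] and at [N'] cost
    [B * delta] each. *)
Lemma sum_weighted_le (f : nat -> C) (z : C) K (P : pred nat) :
  nm z <= rho ->
  (forall k, P k -> nm (f k) <= B * (ndiv s M (N + k) + ndiv s M (N - k) +
    ((if k == k0 then ndiv s M.+1 (N' + k) else ndiv s M (N' + k))
     + ndiv s M (N' - k)))%:R) ->
  nm (\sum_(k < K | P k) f k * z ^+ k) <= 2 * B * delta.
Proof.
move=> hz hf; have /andP[r0 r1] := rho01.
apply: le_trans (normc_sum _ _ _) _.
apply: (@le_trans _ _ (B * (wdiv s rho M N K + wdiv_except s rho M k0 N' K))); last first.
  rewrite [2 * _]mulrC -mulrA ler_wpM2l ?bound_ge0//.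
  by have := wN K; have := wN' K; lra.
rewrite /wdiv /wdiv_except -big_split /= mulr_sumr big_mkcond.
apply: ler_sum => k _; rewrite -mulrDr -natrD.
have p : 0 <= rho ^+ k by rewrite exprn_ge0.
case: ifP => hP; last by rewrite !mulr_ge0 ?bound_ge0.
rewrite ComplexField.Normc.normcM normcX mulrCA [rho ^+ k * _]mulrC.
apply: ler_pM; rewrite ?normc_ge0 ?exprn_ge0 ?normc_ge0 ?hf//.
by apply: lerXn2r; rewrite ?nnegrE ?normc_ge0.
Qed.

(** For [k < minn N N'] the congruences cancel the first [M] terms of [beta (N - k)] and
    [beta (N' - k)]. What remains is the sparse high part, and a low part whose powers of [z] are so
    high that [hmin] makes it small. *)
Lemma close_inside gam z : nm z <= rho ->
  (forall n, (minn N N' <= n)%N ->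
     rho ^+ n <= delta /\ M%:R * rho ^+ n / (1 - rho) <= delta) ->
  nm (horner_seq gam z N - horner_seq gam z N') <= (2 * nm gam + 3 * B) * delta.
Proof.
move=> hz hmin; have /andP[r0 r1] := rho01.
pose K := maxn N N'.
rewrite (@horner_seqE gam z N K) ?leq_maxl// (@horner_seqE gam z N' K) ?leq_maxr//.
(* The guards are needed because [beta 0 = 0], whereas every [s i] divides 0. *)
pose low k : C := if (k < minn N N')%N then 0 else
  (if (0 < N - k)%N then \sum_(0 <= i < M) term i (N - k) else 0) -
  (if (0 < N' - k)%N then \sum_(0 <= i < M) term i (N' - k) else 0).
pose high k : C := \sum_(M <= i < N - k) term i (N - k)
   - \sum_(M <= i < N' - k) term i (N' - k).
have dE k : beta (N - k) - beta (N' - k) = low k + high k.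
  rewrite /low /high; case: ltnP => h.
    rewrite !(@beta_split M) ?subn_gt0; try by lia.
    have -> : \sum_(0 <= i < M) term i (N - k) = \sum_(0 <= i < M) term i (N' - k).
      rewrite !big_mkord; apply: eq_bigr => i _.
      by apply: term_congr; apply: modB_congr; rewrite ?NNs//; lia.
    by ring.
  have bE n : beta n = (if (0 < n)%N then \sum_(0 <= i < M) term i n else 0) +
      \sum_(M <= i < n) term i n.
    case: ifP => [/(beta_split M)//|/negbT]; rewrite -leqNgt leqn0 => /eqP ->.
    by rewrite beta0 big_geq// addr0.
  by rewrite !bE; ring.
have -> : gam * z ^+ N + \sum_(k < K) beta (N - k) * z ^+ k -
    (gam * z ^+ N' + \sum_(k < K) beta (N' - k) * z ^+ k) =
    gam * (z ^+ N - z ^+ N') + \sum_(k < K) low k * z ^+ k +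
    \sum_(k < K) high k * z ^+ k.
  rewrite -[RHS]addrA -big_split /= opprD addrACA -mulrBr; congr (_ + _).
  rewrite -sumrB; apply: eq_bigr => k _; rewrite -mulrDl -dE; ring.
have zX n : nm (z ^+ n) <= rho ^+ n.
  by rewrite normcX; apply: lerXn2r; rewrite ?nnegrE ?normc_ge0.
have b1 : nm (gam * (z ^+ N - z ^+ N')) <= 2 * nm gam * delta.
  rewrite ComplexField.Normc.normcM [2 * _]mulrC -mulrA ler_wpM2l ?normc_ge0//.
  apply: le_trans (normcB _ _) _.
  have := zX N; have := zX N'.
  have [|h1 _] := hmin N; first by rewrite geq_minl.
  have [|h2 _] := hmin N'; first by rewrite geq_minr.
  by lra.
have b2 : nm (\sum_(k < K) high k * z ^+ k) <= 2 * B * delta.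
  apply: (@sum_weighted_le high z K xpredT hz) => k _.
  apply: le_trans (normcB _ _) _.
  apply: le_trans (lerD (high_le _ _) (high_le _ _)) _.
  by rewrite -mulrDr -natrD ler_wpM2l ?bound_ge0// ler_nat; lia.
have b3 : nm (\sum_(k < K) low k * z ^+ k) <= B * delta.
  apply: le_trans (normc_sum _ _ _) _.
  have [|_ h1] := hmin (minn N N'); first by [].
  apply: (@le_trans _ _ (B * (M%:R * rho ^+ (minn N N') / (1 - rho)))); last first.
    by rewrite ler_wpM2l ?bound_ge0.
  apply: (@le_trans _ _ (B * M%:R *
      \sum_(k < K | (minn N N' <= k)%N) rho ^+ k)); last first.
    by rewrite -!mulrA ler_wpM2l ?bound_ge0// ler_wpM2l// geo_tail_le.
  rewrite mulr_sumr [X in _ <= X]big_mkcond /=; apply: ler_sum => k _.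
  rewrite /low ltnNge; case: (leqP (minn N N') k) => /= h; last first.
    by rewrite mul0r ComplexField.Normc.normc0.
  rewrite ComplexField.Normc.normcM; apply: ler_pM; rewrite ?normc_ge0//.
  have B0 : 0 <= B * M%:R by rewrite mulr_ge0 ?bound_ge0.
  (* Beyond the minimum one of the differences [N - k], [N' - k] is 0, so at most one low sum
     survives. *)
  case: ifP => p1; case: ifP => p2; rewrite ?subr0 ?sub0r ?normcN.
  - by exfalso; lia.
  - exact: low_le.
  - exact: low_le.
  - by rewrite ?ComplexField.Normc.normc0.
apply: le_trans (le_normcD _ _) _; apply: le_trans (lerD (le_normcD _ _) b2) _.
by lra.
Qed.

Hypothesis dM : (s M %| N' + k0)%N.
Hypothesis MN' : (M < N')%N.

(** Expand both values forward by [horner_seq_shift]. The low parts cancel by congruence, and the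
    unmatched divisibility of [N' + k0] by [s M] produces the main term. *)
Lemma close_outside gam z u : z * u = 1 -> nm u <= rho ->
  (forall eta : R, 0 < eta ->
     exists n0, forall n, (n0 <= n)%N -> nm (u ^+ n * horner_seq gam z n) <= eta) ->
  nm (horner_seq gam z N - horner_seq gam z N' - w M (N' + k0) * u ^+ k0)
    <= 2 * B * delta.
Proof.
move=> zu hu hlim; apply/ler_addgt0Pr => eta eta0.
have z0 : 0 < nm z.
  rewrite lt_neqAle normc_ge0 andbT eq_sym; apply/eqP => /ComplexField.Normc.eq0_normc z0.
  by move: zu; rewrite z0 mul0r => /esym/eqP; rewrite oner_eq0.
(* Compensates the factor [z ^+ n] between [u ^+ K] and [u ^+ (n + K)]. *)
pose eta' n := eta / 2 / nm z ^+ n.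
have e0' n : 0 < eta' n by rewrite !divr_gt0// exprn_gt0.
have lim n : exists K0, forall K, (K0 <= K)%N ->
    nm (u ^+ K * horner_seq gam z (n + K)) <= eta / 2.
  have [n0 hn0] := hlim _ (e0' n); exists n0 => K hK.
  have -> : u ^+ K * horner_seq gam z (n + K) =
     z ^+ n * (u ^+ (n + K) * horner_seq gam z (n + K)).
    by rewrite exprD !mulrA -exprMn zu expr1n mul1r.
  rewrite ComplexField.Normc.normcM normcX mulrC -ler_pdivlMr ?exprn_gt0//.
  by apply: hn0; rewrite (leq_trans hK)// leq_addl.
have [K1 hK1] := lim N; have [K2 hK2] := lim N'.
pose K := maxn k0 (maxn K1 K2).
rewrite (horner_seq_shift gam N K zu) (horner_seq_shift gam N' K zu).
pose D k : C := beta (N' + k) - beta (N + k) - (if k == k0 then w M (N' + k0) else 0).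
have -> : u ^+ K * horner_seq gam z (N + K) -
    \sum_(k < K.+1 | (0 < k)%N) beta (N + k) * u ^+ k -
    (u ^+ K * horner_seq gam z (N' + K) -
     \sum_(k < K.+1 | (0 < k)%N) beta (N' + k) * u ^+ k) - w M (N' + k0) * u ^+ k0
  = (u ^+ K * horner_seq gam z (N + K) - u ^+ K * horner_seq gam z (N' + K))
    + \sum_(k < K.+1 | (0 < k)%N) D k * u ^+ k.
  have -> : w M (N' + k0) * u ^+ k0 =
      \sum_(k < K.+1 | (0 < k)%N) (if k == k0 :> nat then w M (N' + k0) else 0) * u ^+ k.
    have kK : (k0 < K.+1)%N by rewrite ltnS leq_maxl.
    rewrite (bigD1 (Ordinal kK)) //= eqxx big1 ?addr0// => k /andP[_ hk].
    case: eqP => [e|]; last by rewrite mul0r.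
    by move: hk; rewrite -val_eqE /= e eqxx.
  have -> : \sum_(k < K.+1 | (0 < k)%N) D k * u ^+ k =
      \sum_(k < K.+1 | (0 < k)%N) beta (N' + k) * u ^+ k -
      \sum_(k < K.+1 | (0 < k)%N) beta (N + k) * u ^+ k -
      \sum_(k < K.+1 | (0 < k)%N) (if k == k0 :> nat then w M (N' + k0) else 0) * u ^+ k.
    by rewrite -!sumrB; apply: eq_bigr => k _; rewrite /D !mulrBl.
  by ring.
apply: le_trans (le_normcD _ _) _; rewrite addrC; apply: lerD; last first.
  apply: le_trans (normcB _ _) _.
  have := hK1 K; have := hK2 K.
  have -> : (K1 <= K)%N by rewrite /K; lia.
  have -> : (K2 <= K)%N by rewrite /K; lia.
  by move=> /(_ isT) ? /(_ isT) ?; lra.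
apply: (@sum_weighted_le D u K.+1 (fun k => (0 < k)%N) hu) => k hk.
have -> : D k = (if k == k0 then \sum_(M.+1 <= i < N' + k) term i (N' + k)
   else \sum_(M <= i < N' + k) term i (N' + k)) - \sum_(M <= i < N + k) term i (N + k).
  rewrite /D !(@beta_split M) ?addn_gt0 ?hk ?orbT//.
  have -> : \sum_(0 <= i < M) term i (N + k) = \sum_(0 <= i < M) term i (N' + k).
    rewrite !big_mkord; apply: eq_bigr => i _.
    by apply: term_congr; apply: modD_congr; rewrite ?NNs.
  case: eqP => [->|_]; last by ring.
  (* At [k0] the index [M] is split off the high sum; its term is the subtracted [w M (N' + k0)]. *)
  rewrite [X in _ + X - _ - _](@big_ltn _ _ _ M) ?(leq_trans MN') ?leq_addr//.
  by rewrite /term dM; ring.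
apply: le_trans (normcB _ _) _.
apply: (@le_trans _ _ (B * (if k == k0 then ndiv s M.+1 (N' + k) else ndiv s M (N' + k))%:R
   + B * (ndiv s M (N + k))%:R)).
  by apply: lerD; [case: ifP => _; exact: high_le | exact: high_le].
by rewrite -mulrDr -natrD ler_wpM2l ?bound_ge0// ler_nat; lia.
Qed.

End Estimates.

(** * Integrality *)

Section Integrality.

Lemma horner_char_poly (F : comNzRingType) n (A : 'M[F]_n) (w : F) :
  (char_poly A).[w] = \det (w%:M - A).
Proof.
rewrite /char_poly -[LHS]/(horner_eval w _) -det_map_mx; congr (\det _).
apply/matrixP => i j.
by rewrite !mxE /= horner_evalE hornerD hornerN hornerC hornerMn hornerX.
Qed.

(** Both sides are multiplicative in [g], so linear factors suffice; for ['X - w] the determinant is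
    the characteristic polynomial at [w] up to sign. *)
Lemma det_horner_mx (F : closedFieldType) n (A : 'M[F]_n.+1) (g : {poly F}) rs :
  char_poly A = \prod_(z <- rs) ('X - z%:P) ->
  \det (horner_mx A g) = \prod_(z <- rs) g.[z].
Proof.
move=> chA.
have size_rs : size rs = n.+1.
  by have := size_char_poly A; rewrite chA size_prod_XsubC => -[].
have [ws ->] := closed_field_poly_normal g.
rewrite -mul_polyC; elim: ws => [|w ws IH].
  rewrite big_nil mulr1 horner_mx_C det_scalar -size_rs.
  under eq_bigr do rewrite hornerC.
  by rewrite big_const_seq count_predT iter_mulr_1.
rewrite big_cons mulrCA rmorphM det_mulmx IH /= rmorphB /= horner_mx_X horner_mx_C.
under [RHS]eq_bigr do rewrite hornerM hornerXsubC.
rewrite big_split /=; congr (_ * _).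
(* The sign is spread over the roots, turning each [w - z] into [z - w]. *)
rewrite -opprB -scaleN1r detZ -horner_char_poly chA horner_prod -size_rs.
rewrite -[(-1) ^+ _](iter_mulr_1) -[size rs](count_predT rs) -big_const_seq -big_split.
by apply: eq_bigr => z _ /=; rewrite hornerXsubC mulN1r opprB.
Qed.

Variable F : numClosedFieldType.
Notation ev g z := (map_poly (intr : int -> F) g).[z].

(** The companion matrix of [m] has integer entries, and the product is the determinant of [g]
    evaluated at it. *)
Lemma prod_roots_int (m g : {poly int}) rs : m \is monic -> (1 < size m)%N ->
  map_poly (intr : int -> F) m = \prod_(z <- rs) ('X - z%:P) ->
  exists k : int, \prod_(z <- rs) ev g z = k%:~R.
Proof.
move=> mm sm mE.
have [n [A chA]] : exists n (A : 'M[int]_n.+1), char_poly A = m.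
  move: (companionmx m) (companionmxK mm); case: (size m) sm => [|[|n]]// _ A h.
  by exists n, A.
exists (\det (horner_mx A g)).
rewrite -[RHS]/(intr _) -det_map_mx map_horner_mx.
by apply/esym/det_horner_mx; rewrite -map_char_poly chA.
Qed.

(** * Integer polynomials of least degree vanishing at a point *)

Definition min_int_poly (a : {poly int}) (x : F) :=
  [/\ a != 0, ev a x = 0 &
      forall g : {poly int}, g != 0 -> ev g x = 0 -> (size a <= size g)%N].

Lemma evM (p q : {poly int}) x : ev (p * q) x = ev p x * ev q x.
Proof. by rewrite rmorphM hornerM. Qed.

Lemma evZ (k : int) (p : {poly int}) x : ev (k *: p) x = k%:~R * ev p x.
Proof. by rewrite map_polyZ hornerZ. Qed.

Lemma min_int_poly_dvd a g x : min_int_poly a x -> ev g x = 0 -> a %| g.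
Proof.
move=> [a0 ax amin] gx; apply/modp_eq0P/eqP; apply: contraT => r0.
have := amin _ r0; rewrite leqNgt ltn_modp a0 /=; apply.
have /(congr1 (fun p => ev p x)) := Pdiv.Idomain.divp_eq g a.
by rewrite evZ gx mulr0 rmorphD hornerD evM ax mulr0 add0r.
Qed.

(** Descent on the size: a polynomial that is not minimal is replaced by a shorter one. *)
Lemma min_int_poly_exists (P : {poly int}) x : P != 0 -> ev P x = 0 ->
  exists a, min_int_poly a x.
Proof.
have [n] := ubnP (size P); elim: n P => // n IH P sP P0 Px.
have [h|/existsNP[g /not_implyP[g0 /not_implyP[gx /negP gs]]]] :=
  pselect (forall g : {poly int}, g != 0 -> ev g x = 0 -> (size P <= size g)%N).
  by exists P.
by apply: (IH g) => //; rewrite -ltnNge in gs; apply: leq_trans gs _.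
Qed.

(** Gauss's lemma: the primitive part of a minimal [a] divides [P] over the integers, so its leading
    coefficient divides 1; it is positive by normalization. *)
Lemma min_int_poly_monic (P : {poly int}) x : P \is monic -> ev P x = 0 ->
  exists m, m \is monic /\ min_int_poly m x.
Proof.
move=> Pm Px; have P0 := monic_neq0 Pm.
have [a amin] := min_int_poly_exists P0 Px.
have [a0 ax amin'] := amin.
have [r rE] := dvdpP_int (min_int_poly_dvd amin Px).
exists (zprimitive a); split.
  have /eqP := sgz_lead_primitive a; rewrite a0 sgz_cp0.
  move/monicP: Pm; rewrite rE lead_coefM monicE.
  move: (lead_coef _) (lead_coef _) => u v /(congr1 absz)/eqP.
  by rewrite abszM muln_eq1 => /andP[/eqP u1 _] u0; lia.
split; rewrite ?zprimitive_eq0 ?size_zprimitive//.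
have /eqP := ax; rewrite {1}(zpolyEprim a) evZ mulf_eq0 intr_eq0 => /orP[|/eqP //].
by rewrite zcontents_eq0 (negPf a0).
Qed.

Lemma min_int_poly_size m x : min_int_poly m x -> (1 < size m)%N.
Proof.
move=> [m0 mx _]; rewrite ltnNge; apply/negP => /size1_polyC e.
move: mx m0; rewrite e map_polyC hornerC /= polyC_eq0 => /eqP.
by rewrite intr_eq0 => ->.
Qed.

(** A minimal [a] at [z] divides [m] and [g] up to integer factors. If [a] did not vanish at [x],
    the cofactor of [a] in [m] would, and it is shorter than [m]. *)
Lemma min_int_poly_conj m g x z : min_int_poly m x ->
  ev m z = 0 -> ev g z = 0 -> ev g x = 0.
Proof.
move=> mmin mz gz; have [m0 mx mle] := mmin.
have [a amin] := min_int_poly_exists m0 mz.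
have [a0 az _] := amin.
have /Pdiv.Idomain.dvdpP[[k q] /= k0 kE] := min_int_poly_dvd amin mz.
have /Pdiv.Idomain.dvdpP[[k' q'] /= k0' kE'] := min_int_poly_dvd amin gz.
have q0 : q != 0.
  by apply: contraNneq m0 => q0; move/eqP: kE; rewrite q0 mul0r scale_poly_eq0 (negPf k0).
suff ax : ev a x = 0.
  have := congr1 (fun p => ev p x) kE'; rewrite /= evZ evM ax mulr0 => /eqP.
  by rewrite mulf_eq0 intr_eq0 (negPf k0') => /eqP.
have := congr1 (fun p => ev p x) kE; rewrite /= evZ evM mx mulr0 => /esym/eqP.
rewrite mulf_eq0 => /orP[/eqP /(mle _ q0)|/eqP//].
have := congr1 (fun p : {poly int} => size p) kE; rewrite /= size_scale// => ->.
have := min_int_poly_size amin; rewrite size_mul//.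
by case: (size a) => [|[|n]]// _; rewrite !addnS /= ltnNge leq_addr.
Qed.

(* The product of the values of g at the conjugates is an integer, hence
   vanishes as soon as it is smaller than 1. *)
Lemma small_conjugates_eq0 m g x : m \is monic -> min_int_poly m x ->
  (forall z, ev m z = 0 -> `|ev g z| < 1) -> ev g x = 0.
Proof.
move=> mm mmin hg.
have [rs mE] := closed_field_poly_normal (map_poly (intr : int -> F) m).
rewrite (monicP (monic_map _ mm)) scale1r in mE.
have rsz z : z \in rs -> ev m z = 0.
  by move=> hz; apply/eqP; rewrite -/(root _ z) mE root_prod_XsubC.
have [k kE] := prod_roots_int g mm (min_int_poly_size mmin) mE.
have [|/hasPn nz] := boolP (has (fun z => ev g z == 0) rs).
  by move=> /hasP[z /rsz zr /eqP gz]; exact: min_int_poly_conj mmin zr gz.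
exfalso; have k0 : k != 0.
  rewrite -(intr_eq0 F) -kE prodf_seq_neq0; apply/allP => z hz /=; exact: nz.
have : `|k%:~R : F| < 1.
  rewrite -kE normr_prod.
  have : (0 < size rs)%N.
    have := min_int_poly_size mmin.
    by rewrite -(size_map_inj_poly (@intr_inj F)) ?rmorph0// mE size_prod_XsubC.
  case: rs {mE kE} rsz nz => // z0 rs rsz nz _.
  rewrite big_cons (@le_lt_trans _ _ `|ev g z0|)//; last first.
    by apply/hg/rsz; rewrite mem_head.
  rewrite ler_piMr// big_seq prodr_ile1// => z hz.
  by rewrite normr_ge0 ltW//; apply/hg/rsz; rewrite inE hz orbT.
by rewrite -intr_norm -[1]/(1%:~R) ltr_int ltNge -gtz0_ge1 normr_gt0 k0.
Qed.
End Integrality.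

(** * The linear relation over the complex numbers *)

Section Core.
Variable R : realType.
Local Notation C := R[i].
Local Notation nm := (@ComplexField.Normc.normc R).
Local Notation ev g z := (map_poly (intr : int -> C) g).[z].

Variable s : nat -> nat.
Hypothesis s_gt : forall i, (i < s i)%N.
Hypothesis s_odd : forall i, odd (s i).
Hypothesis s_coprime : forall i j, i != j -> coprime (s i) (s j).
Hypothesis s_tail : forall eps : R, 0 < eps ->
  exists M, forall L, \sum_(M <= i < L) (s i)%:R^-1 <= eps.

Lemma seq_bound (T : eqType) (f : T -> R) (rs : seq T) :
  exists B, 0 < B /\ forall z, z \in rs -> f z <= B.
Proof.
elim: rs => [|z rs [B [B0 hB]]]; first by exists 1.
exists (Num.max B (f z)); split; first by rewrite lt_max B0.
move=> y; rewrite inE le_max => /orP[/eqP ->|/hB ->//]; by rewrite lexx orbT.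
Qed.

(** Provides one ratio [rho < 1] that serves both the inverse of alpha and all conjugates inside the
    disk. *)
Lemma seq_bound_lt1 (T : eqType) (f : T -> R) (rs : seq T) (r0 : R) : 0 <= r0 < 1 ->
  exists rho, [/\ 0 <= rho < 1, r0 <= rho &
                forall z, z \in rs -> f z < 1 -> f z <= rho].
Proof.
move=> r01; elim: rs => [|z rs [rho [/andP[h0 h1] h2 h3]]]; first by exists r0.
have [fz|fz] := ltP (f z) 1.
  exists (Num.max rho (f z)); split.
  - by rewrite le_max h0 /= gt_max h1 fz.
  - by rewrite le_max h2.
  - move=> y; rewrite inE le_max => /orP[/eqP ->|hy /(h3 _ hy) ->//].
    by rewrite lexx orbT.
exists rho; split=> //; first by rewrite h0 h1.
move=> y; rewrite inE => /orP[/eqP ->|]; last exact: h3.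
by rewrite ltNge fz.
Qed.

Lemma normc_lt1 (x : C) : (`|x| < 1) = (nm x < 1).
Proof. by rewrite -[1 : C]/(1%:C%C) -[`|x|]/((nm x)%:C%C) ltcR. Qed.

Lemma normc_conj (x : C) : nm (x^*)%C = nm x.
Proof. by case: x => a b /=; rewrite sqrrN. Qed.

Lemma ev_conj (g : {poly int}) (x : C) : ev g (x^*)%C = ((ev g x)^*)%C.
Proof.
rewrite -horner_map /=; congr (_.[_]); rewrite -map_poly_comp.
by apply: eq_map_poly => k /=; rewrite rmorph_int.
Qed.

Variables (gam : {poly int}) (c : nat -> {poly int}).

(** [c] is indexed by residues modulo 4. A term congruent to 1 counts in [b_j] for [j] congruent to
    [n], and one congruent to 3 for [j] congruent to [n + 2]. *)
Definition coef_poly i n : {poly int} :=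
  if (s i %% 4 == 1)%N then c (n %% 4)%N else c ((n + 2) %% 4)%N.

Fixpoint Apoly n : {poly int} :=
  if n is n'.+1 then 'X * Apoly n' +
     \sum_(0 <= i < n) (if (s i %| n)%N then coef_poly i n else 0)
  else gam.

Lemma ev_Apoly z n :
  ev (Apoly n) z = horner_seq s (fun i k => ev (coef_poly i k) z) (ev gam z) z n.
Proof.
elim: n => [|n IH] //=.
rewrite rmorphD rmorphM /= map_polyX hornerD hornerM hornerX IH; congr (_ + _).
rewrite rmorph_sum /= horner_sum; apply: eq_bigr => i _.
by rewrite /term; case: ifP => // _; rewrite map_poly0 horner0.
Qed.

Variables (alpha : C) (m : {poly int}).
Hypothesis alpha_gt1 : 1 < nm alpha.
Hypothesis m_monic : m \is monic.
Hypothesis m_min : min_int_poly m alpha.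
Hypothesis m_roots : forall z, ev m z = 0 ->
  [\/ z = alpha, z = (alpha^*)%C | nm z < 1].
Hypothesis lim0 : forall eta : R, 0 < eta -> exists n0, forall n, (n0 <= n)%N ->
  nm (alpha^-1 ^+ n * ev (Apoly n) alpha) <= eta.

(** A nonzero value of [c j] would make [G] small at all conjugates, hence zero at [alpha], although
    it is close to a nonzero number there. *)
Lemma coef_eq0 j : (j < 4)%N -> ev (c j) alpha = 0.
Proof.
move=> j4; apply/eqP; apply: contraT => cj0.
have a0 : 0 < nm alpha by apply: lt_trans alpha_gt1.
have al0 : alpha != 0.
  by apply: contraTneq a0 => ->; rewrite ComplexField.Normc.normc0 ltxx.
set u := alpha^-1.
have zu : alpha * u = 1 by rewrite divff.
have nu : nm u = (nm alpha)^-1 by rewrite ComplexField.Normc.normcV.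
have u01 : 0 <= nm u < 1 by rewrite normc_ge0 nu invf_lt1.
have [rs mE] := closed_field_poly_normal (map_poly (intr : int -> C) m).
rewrite (monicP (monic_map _ m_monic)) scale1r in mE.
have rsz z : ev m z = 0 -> z \in rs.
  by move=> mz; rewrite -root_prod_XsubC -mE; apply/eqP.
have al_rs : alpha \in rs by apply: rsz; case: m_min.
have [rho [rho01 urho rhoP]] := @seq_bound_lt1 _ nm rs (nm u) u01.
have [B [B0 hB]] := @seq_bound _
  (fun z => nm (ev gam z) + \sum_(i < 4) nm (ev (c i) z)) rs.
have hgam z : z \in rs -> nm (ev gam z) <= B.
  move=> /hB; apply: le_trans; rewrite lerDl sumr_ge0// => i _; exact: normc_ge0.
have hc z i : z \in rs -> (i < 4)%N -> nm (ev (c i) z) <= B.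
  move=> /hB h i4; apply: le_trans h; rewrite (bigD1 (Ordinal i4)) //= addrCA lerDl.
  by rewrite addr_ge0 ?normc_ge0 ?sumr_ge0// => k _; exact: normc_ge0.
have hw z : z \in rs -> forall i n, nm (ev (coef_poly i n) z) <= B.
  by move=> hz i n; rewrite /coef_poly; case: ifP => _; apply: hc; rewrite ?ltn_mod.
have wmod z i n n' : n = n' %[mod 4] -> ev (coef_poly i n) z = ev (coef_poly i n') z.
  by move=> e; rewrite /coef_poly -[in LHS](modnDml n) e modnDml.
have [|n0 hn0] := @expr_small R rho ((2 * B)^-1) rho01.
  by rewrite invr_gt0 mulr_gt0.
(* [k0] is fixed before [delta]: the main term at [alpha] is below 1/2, and its modulus [v] stays a
   fixed positive number. *)
pose k0 := n0.+1.
have rk0 : B * rho ^+ k0 < 1 / 2.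
  by rewrite mulrC -ltr_pdivlMr// div1r -invfM; apply: hn0; rewrite leqnSn.
pose v := nm (ev (c j) alpha * u ^+ k0).
have v0 : 0 < v.
  rewrite lt_neqAle normc_ge0 andbT eq_sym; apply/eqP => /ComplexField.Normc.eq0_normc/eqP.
  by rewrite mulf_eq0 expf_eq0 invr_eq0 (negPf cj0) (negPf al0) andbF.
(* The bound [1 / 2] keeps [G] below 1 at every conjugate; the bound [v / 2] contradicts [G]
   vanishing at [alpha]. *)
pose eta := Num.min (1 / 2) (v / 2).
have eta0 : 0 < eta by rewrite lt_min !divr_gt0.
have eta1 : eta <= 1 / 2 by rewrite ge_min lexx.
have eta2 : eta <= v / 2 by rewrite ge_min lexx orbT.
pose delta := eta / (6 * B).
have delta0 : 0 < delta by rewrite divr_gt0// mulr_gt0.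
have dB : B * delta = eta / 6 by rewrite /delta; field; rewrite gt_eqF.
(* With this residue for [N' + k0], [coef_poly M] selects [c j] whichever odd class [s M] has modulo
   4. *)
pose g i := if (s i %% 4 == 1)%N then j else (j + 2)%N.
have [M [N [N' [[N4 Ns dM gM] [MN' wN wN' hmin]]]]] :=
  @close_pair R s s_gt s_odd s_coprime s_tail rho delta k0 g rho01 delta0 isT.
pose G := Apoly N - Apoly N'.
have evG z : ev G z = ev (Apoly N) z - ev (Apoly N') z by rewrite rmorphB hornerD hornerN.
have wM : ev (coef_poly M (N' + k0)) alpha = ev (c j) alpha.
  rewrite /coef_poly; move: gM; rewrite /g; case: ifP => _ e.
    by rewrite e modn_small.
  by rewrite -modnDml e modnDml -addnA modnDr modn_small.
have far : nm (ev G alpha - ev (c j) alpha * u ^+ k0) <= 2 * B * delta.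
  rewrite evG !ev_Apoly -wM.
  apply: (close_outside s_gt (wmod alpha) (hw alpha al_rs) rho01 _ N4 Ns wN wN' dM MN'
    zu urho) => //.
  by move=> e e0; have [n1 h1] := lim0 e0; exists n1 => n /h1; rewrite ev_Apoly.
have near z : z \in rs -> nm z < 1 -> nm (ev G z) < 1.
  move=> hz z1; rewrite evG !ev_Apoly.
  apply: le_lt_trans (close_inside s_gt (wmod z) (hw z hz) rho01
    (ltn0Sn n0 : (0 < k0)%N) N4 Ns wN wN' (ev gam z) (rhoP _ hz z1) hmin) _.
  apply: (@le_lt_trans _ _ (5 * B * delta)).
    by rewrite ler_wpM2r ?(ltW delta0)//; have := hgam z hz; lra.
  by rewrite -mulrA dB; lra.
have Galpha : nm (ev G alpha) < 1.
  have -> : ev G alpha = (ev G alpha - ev (c j) alpha * u ^+ k0) + ev (c j) alpha * u ^+ k0.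
    by rewrite subrK.
  apply: le_lt_trans (le_normcD _ _) _.
  have : nm (ev (c j) alpha * u ^+ k0) <= B * rho ^+ k0.
    rewrite ComplexField.Normc.normcM normcX; apply: ler_pM.
    - exact: normc_ge0.
    - by rewrite exprn_ge0// normc_ge0.
    - exact: hc.
    - by apply: lerXn2r; rewrite ?nnegrE ?normc_ge0//; case/andP: rho01.
  by move: far; rewrite -mulrA dB; lra.
have G0 : ev G alpha = 0.
  apply: (small_conjugates_eq0 m_monic m_min) => z mz; rewrite normc_lt1.
  have hz := rsz _ mz; case: (m_roots mz) => [->|->|z1] //.
  - by rewrite ev_conj normc_conj.
  - exact: near.
by move: far; rewrite G0 sub0r normcN -/v -mulrA dB; lra.
Qed.
End Core.

(** * Transfer to the complex numbers of the statement *)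

Section Bridge.
Local Open Scope ring_scope.
Local Notation RR := Rdefinitions.R.
Local Notation C := RR[i].
Local Notation nm := (@ComplexField.Normc.normc RR).
Local Notation ev g z := (map_poly (intr : int -> C) g).[z].

Definition toC (x : Cx) : C := Complex (re x) (im x).
Definition ofC (x : C) : Cx := mkC (complex.Re x) (complex.Im x).

Lemma ofCK x : toC (ofC x) = x. Proof. by case: x. Qed.
Lemma toCK x : ofC (toC x) = x. Proof. by case: x. Qed.
Lemma toC_inj : injective toC. Proof. exact: can_inj toCK. Qed.
Lemma toC0 : toC Cx0 = 0. Proof. by []. Qed.
Lemma toC1 : toC Cx1 = 1. Proof. by []. Qed.
Lemma toCD x y : toC (Cadd x y) = toC x + toC y. Proof. by []. Qed.
Lemma toCM x y : toC (Cmul x y) = toC x * toC y. Proof. by []. Qed.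

Lemma toCV x : toC (Cinv x) = (toC x)^-1.
Proof.
case: x => a b; rewrite /toC /Cinv /=; congr (Complex _ _).
by rewrite /= RdivE RoppE mulNr.
Qed.

Lemma toCX x n : toC (Cpow x n) = toC x ^+ n.
Proof. by elim: n => [|n IH] //=; rewrite toCM IH exprS. Qed.

Lemma Cnorm_normc x : Cnorm x = nm (toC x).
Proof. by case: x => a b; rewrite /Cnorm /toC /= RsqrtE. Qed.

Lemma toC_R x : toC (RtoC x) = (x%:C)%C. Proof. by []. Qed.

Lemma toC_INR n : toC (RtoC (INR n)) = n%:R.
Proof. by rewrite toC_R INRE rmorph_nat. Qed.

Lemma IZR_of_int k : IZR (Z_of_int k) = k%:~R.
Proof.
case: k => n /=; first by rewrite -INR_IZR_INZ INRE.
by rewrite opp_IZR -INR_IZR_INZ INRE addn1.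
Qed.

Lemma IZR_int z : IZR z = (int_of_Z z)%:~R.
Proof. by rewrite -IZR_of_int int_of_ZK. Qed.

Lemma toC_Z z : toC (ZtoC z) = (int_of_Z z)%:~R.
Proof. by rewrite /ZtoC toC_R IZR_int rmorph_int. Qed.

Lemma toC_peval l z : toC (peval l z) = (Poly (map toC l)).[toC z].
Proof.
elim: l => [|a l IH] /=; first by rewrite horner0.
by rewrite toCD toCM IH horner_cons mulrC addrC.
Qed.

Lemma nat_modE m d : Nat.modulo m d = (m %% d)%N.
Proof.
case: d => [|d]; first by rewrite modn0 PeanoNat.Nat.mod_0_r.
apply/esym/(PeanoNat.Nat.mod_unique _ _ (m %/ d.+1)%N).
  by apply/ssrnat.ltP; rewrite ltn_pmod.
by rewrite {1}(divn_eq m d.+1) mulnC.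
Qed.

Lemma length_filterE (T : Type) (p : T -> bool) (l : seq T) :
  length (List.filter p l) = (\sum_(i <- l) p i)%N.
Proof.
elim: l => [|i l IH] /=; first by rewrite big_nil.
by rewrite big_cons -IH; case: (p i).
Qed.

Lemma nat_eqbE m n : Nat.eqb m n = (m == n).
Proof. by apply/PeanoNat.Nat.eqb_spec/idP => /eqP. Qed.

Lemma count_divE s r m :
  count_div s r m = (\sum_(0 <= i < m) ((s i %| m) && (s i %% 4 == r)))%N.
Proof.
rewrite /count_div length_filterE /index_iota subn0.
have -> : List.seq 0 m = iota 0 m by elim: m (0%N) => //= m IH k; rewrite IH.
by apply: eq_bigr => i _; rewrite !nat_modE !nat_eqbE.
Qed.

(** The partial sum of index [N] ends with the power [N + 1], hence the bound [N.+2]. *)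
Lemma fpartialE s j z N :
  toC (fpartial s j z N) = \sum_(1 <= k < N.+2) (b s j k)%:R * toC z ^+ k.
Proof.
elim: N => [|N IH]; first by rewrite big_nat1 /= toCM toC_INR expr1.
by rewrite big_nat_recr //= toCD IH toCM toC_INR toCM toCM toCX -!exprS.
Qed.

(* The residue classes 0, ..., 3 of the index correspond to f_4, f_1, f_2, f_3. *)
Lemma sum_b s (c : nat -> {poly int}) z n : (forall i, odd (s i)) ->
  ev (c 1%N) z * (b s 1 n)%:R + ev (c 2%N) z * (b s 2 n)%:R +
  ev (c 3%N) z * (b s 3 n)%:R + ev (c 0%N) z * (b s 4 n)%:R =
  \sum_(0 <= i < n) (if (s i %| n)%N then ev (coef_poly s c i n) z else 0).
Proof.
move=> s_odd.
have -> : \sum_(0 <= i < n) (if (s i %| n)%N then ev (coef_poly s c i n) z else 0) =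
    ev (c (n %% 4)%N) z * (a1 s n)%:R + ev (c ((n + 2) %% 4)%N) z * (a3 s n)%:R.
  rewrite /a1 /a3 !count_divE !natr_sum !mulr_sumr -big_split; apply: eq_bigr => i _ /=.
  case: ifP => _ /=; last by rewrite !mulr0 addr0.
  have s4 : (s i %% 4 == 1)%N || (s i %% 4 == 3)%N by have := s_odd i; lia.
  rewrite /coef_poly; case/orP: s4 => /eqP -> /=; first by rewrite mulr1 mulr0 addr0.
  by rewrite mulr0 mulr1 add0r.
rewrite /b !nat_eqbE !nat_modE -(modnDml n).
have : (n %% 4 < 4)%N by rewrite ltn_mod.
by case: (n %% 4)%N => [|[|[|[|q]]]]//= _; ring.
Qed.

(** * Clearing denominators *)

Lemma list_lastE (T : Type) (l : seq T) d : List.last l d = last d l.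
Proof. by case: l => // x l; elim: l x => //= y l IH x; rewrite -IH. Qed.

Lemma clear_denominators (q : list Q) : exists (D : int) (G : {poly int}),
  D != 0 /\ map_poly (intr : int -> C) G = D%:~R *: Poly (map (fun r => toC (QtoC r)) q).
Proof.
elim: q => [|[n d] q [D [G [D0 hG]]]].
  by exists 1, 0; rewrite map_poly0 scaler0.
exists (int_of_Z (Zpos d) * D), ((int_of_Z n * D)%:P + int_of_Z (Zpos d) *: (G * 'X)).
have d0 : (int_of_Z (Zpos d))%:~R != 0 :> RR.
  by rewrite -IZR_int; apply/eqP; apply: not_0_IZR.
have d0' : int_of_Z (Zpos d) != 0 by rewrite -(intr_eq0 RR).
split; first by rewrite mulf_neq0.
rewrite rmorphD /= map_polyC map_polyZ rmorphM /= map_polyX hG cons_poly_def.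
rewrite scalerDr addrC; congr (_ + _).
  by rewrite -scalerAl scalerA -rmorphM.
rewrite -mul_polyC -polyCM; congr (_%:P).
rewrite /QtoC toC_R /Q2R /= RmultE RinvE !IZR_int !rmorphM /= fmorphV /= !rmorph_int.
have d1 : (int_of_Z (Zpos d))%:~R != 0 :> C by rewrite intr_eq0.
by field.
Qed.

(** The length bound lets minimality among integer polynomials pass to rational ones. *)
Lemma pevalQ_clear (q : list Q) : exists (D : int) (G : {poly int}),
  [/\ D != 0, forall z, ev G (toC z) = D%:~R * toC (pevalQ q z),
      (size G <= length q)%N & (nonzero_polyQ q -> G != 0)].
Proof.
have [D [G [D0 hG]]] := clear_denominators q; exists D, G.
have D0' : D%:~R != 0 :> C by rewrite intr_eq0.
have sG : size G = size (Poly (map (fun r => toC (QtoC r)) q)).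
  by rewrite -(size_map_inj_poly (@intr_inj C)) ?rmorph0// hG size_scale.
split => //.
- move=> z; rewrite hG hornerZ /pevalQ toC_peval; congr (_ * (Poly _).[_]).
  by elim: q {hG sG} => //= a q ->.
- by rewrite sG (leq_trans (size_Poly _))// size_map.
- move=> hq; rewrite -size_poly_gt0 sG.
  suff h : last 1 (map (fun r => toC (QtoC r)) q) != 0.
    by rewrite (PolyK h) size_map; case: q hq {hG sG h} => //; case.
  case: q hq {hG sG} => [|x q hq] /=; first by case.
  rewrite (last_map (fun r => toC (QtoC r))); apply/eqP => h; apply: hq.
  by rewrite list_lastE; apply: eqR_Qeq; case: h => ->; rewrite /Q2R /= Rmult_0_l.
Qed.

Lemma in_Qalpha_int a c : in_Qalpha a c ->
  exists D P : {poly int}, ev D (toC a) != 0 /\ ev D (toC a) * toC c = ev P (toC a).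
Proof.
move=> [p [q [qa ->]]].
have [Dp [Gp [Dp0 hp _ _]]] := pevalQ_clear p.
have [Dq [Gq [Dq0 hq _ _]]] := pevalQ_clear q.
have q0 : toC (pevalQ q a) != 0 by apply/eqP => h; apply: qa; apply: toC_inj.
exists (Dp *: Gq), (Dq *: Gp); rewrite !evZ hp hq; split.
  by rewrite !mulf_neq0 ?intr_eq0.
by rewrite /Cdiv toCM toCV; field.
Qed.

Lemma common_denominator a (c : nat -> Cx) n :
  (forall i, (i < n)%N -> in_Qalpha a (c i)) ->
  exists (D : {poly int}) (P : nat -> {poly int}), ev D (toC a) != 0 /\
    forall i, (i < n)%N -> ev D (toC a) * toC (c i) = ev (P i) (toC a).
Proof.
elim: n => [|n IH] h.
  by exists 1, (fun=> 0); rewrite rmorph1 hornerC oner_neq0.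
have [|D [P [D0 hP]]] := IH; first by move=> i hi; apply: h; rewrite ltnW.
have [D' [P' [D0' hP']]] := in_Qalpha_int (h n (ltnSn n)).
exists (D * D'), (fun i => if (i < n)%N then D' * P i else D * P').
split; first by rewrite evM mulf_neq0.
move=> i; rewrite ltnS leq_eqVlt => /orP[/eqP ->|hi].
  by rewrite ltnn !evM -mulrA hP'.
by rewrite hi !evM mulrAC hP// mulrC.
Qed.

(** * Sequences tending to zero *)

Definition vanishing (e : nat -> C) := forall eta : RR, 0 < eta ->
  exists n0, forall n, (n0 <= n)%N -> nm (e n) <= eta.

Lemma vanishingD e f : vanishing e -> vanishing f -> vanishing (fun n => e n + f n).
Proof.
move=> he hf eta eta0; have eta2 : 0 < eta / 2 by rewrite divr_gt0.
have [n1 h1] := he _ eta2; have [n2 h2] := hf _ eta2.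
exists (maxn n1 n2) => n; rewrite geq_max => /andP[/h1 l1 /h2 l2].
by apply: le_trans (le_normcD _ _) _; lra.
Qed.

Lemma vanishingZ (a : C) e : vanishing e -> vanishing (fun n => a * e n).
Proof.
move=> he eta eta0; have a1 : 0 < nm a + 1 by rewrite ltr_wpDl ?normc_ge0.
have [|n0 h0] := he (eta / (nm a + 1)); first by rewrite divr_gt0.
exists n0 => n /h0; rewrite ler_pdivlMr// ComplexField.Normc.normcM.
by apply: le_trans; rewrite mulrC ler_wpM2l ?normc_ge0// lerDl.
Qed.

Lemma normc_le_coord (x : C) : nm x <= `|complex.Re x| + `|complex.Im x|.
Proof.
case: x => a b; have -> : Complex a b = Complex a 0 + Complex 0 b.
  by congr Complex; rewrite ?addr0 ?add0r.
apply: le_trans (le_normcD _ _) _ => /=.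
by rewrite expr0n /= addr0 add0r !sqrtr_sqr add0r addr0.
Qed.

Lemma f_sum_vanishing s j z F : f_sum s j z F ->
  vanishing (fun n => toC (fpartial s j z n) - toC F).
Proof.
move=> [h1 h2] eta eta0.
have eta2 : 0 < eta / 2 by rewrite divr_gt0.
move/RltP in eta2; have [n1 l1] := h1 _ eta2; have [n2 l2] := h2 _ eta2.
exists (maxn n1 n2) => n; rewrite geq_max => /andP[/ssrnat.leP k1 /ssrnat.leP k2].
apply: le_trans (normc_le_coord _) _ => /=.
have := l1 n k1; have := l2 n k2; rewrite !RdistE => /RltP ? /RltP ?.
by lra.
Qed.

(** Dividing the recursion by [alpha ^+ n] recovers the partial sums of the linear combination of
    the series. *)
Lemma ev_Apoly_scaled s gam c (alpha : C) n : alpha != 0 ->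
  alpha^-1 ^+ n * ev (Apoly s gam c n) alpha = ev gam alpha +
    \sum_(1 <= k < n.+1) (\sum_(0 <= i < k)
       (if (s i %| k)%N then ev (coef_poly s c i k) alpha else 0)) * alpha^-1 ^+ k.
Proof.
move=> a0; rewrite ev_Apoly; elim: n => [|n IH].
  by rewrite big_geq// addr0 mul1r.
rewrite [in RHS]big_nat_recr//= addrA -IH mulrDr exprS; congr (_ + _).
  by rewrite mulrACA mulVf// mul1r.
by rewrite mulrC.
Qed.

(** * The hypotheses on the sequence and on alpha *)

Lemma nat_oddE n : Nat.odd n = odd n.
Proof.
elim: n => // n IH; rewrite PeanoNat.Nat.odd_succ oddS -IH.
by rewrite PeanoNat.Nat.negb_odd.
Qed.

Lemma nat_coprime m n : Nat.gcd m n = 1%N -> coprime m n.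
Proof.
move=> h; rewrite /coprime -dvdn1 -h; apply/dvdnP.
have [z ->] : Nat.divide (gcdn m n) (Nat.gcd m n); last by exists z.
by apply: PeanoNat.Nat.gcd_greatest; apply/dvdnP; rewrite ?dvdn_gcdl ?dvdn_gcdr.
Qed.

Lemma tail_of_Un_cv s l : Un_cv (fun N => sum_f_R0 (fun i => Rinv (INR (s i))) N) l ->
  forall eps : RR, 0 < eps ->
  exists M, forall L, \sum_(M <= i < L) (s i)%:R^-1 <= eps.
Proof.
move=> hl eps e0; have /RltP e0' := e0.
have [N hN] := CV_Cauchy _ (exist _ _ hl) eps e0'.
(* [sum_f_R0] at [N] includes the index [N], so the tail starts at [N.+1]. *)
exists N.+1 => L; have [h|h] := leqP L N.+1; first by rewrite big_geq// ltW.
case: L h => // L h.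
have [/ssrnat.leP k1 /ssrnat.leP k2] : (N <= L)%N /\ (N <= N)%N by lia.
have := hN L N k1 k2; rewrite RdistE !sum_f_R0E => /RltP/ltW.
rewrite (@big_cat_nat _ _ _ N.+1 0 L.+1)//= 1?ltnW// addrAC subrr add0r.
move/(le_trans (ler_norm _)); under eq_bigr do rewrite INRE RinvE; exact.
Qed.


Lemma s_growth (s : nat -> nat) : (forall i j, (i < j)%coq_nat -> (s i < s j)%coq_nat) ->
  (0 < s 0%N)%N -> forall i, (i < s i)%N.
Proof.
move=> h s0; elim=> // i IH.
have /ssrnat.ltP := h i i.+1 (PeanoNat.Nat.lt_succ_diag_r i).
exact: leq_ltn_trans.
Qed.

(** Read over the rationals, [m] remains minimal: a rational competitor becomes an integer one of no
    greater length after clearing denominators. *)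
Lemma conjugate_of_root (m : {poly int}) (alpha : Cx) (z : C) :
  min_int_poly m (toC alpha) -> ev m z = 0 -> conjugate_over_Q alpha (ofC z).
Proof.
move=> [m0 mx mmin] mz.
pose q := map (fun k : int => inject_Z (Z_of_int k)) m.
have qE w : toC (pevalQ q w) = ev m (toC w).
  rewrite /pevalQ toC_peval; congr (_.[_]); apply/polyP => i.
  rewrite coef_Poly coef_map /=.
  have -> : map toC (List.map QtoC q) = map (intr : int -> C) m.
    rewrite /q; elim: (polyseq m) => //= k l ->; congr (_ :: _).
    by rewrite /QtoC toC_R /Q2R /= Rinv_1 Rmult_1_r IZR_of_int rmorph_int.
  have [h|h] := ltnP i (size m); first by rewrite (nth_map 0).
  by rewrite !nth_default// size_map.
have szq : length q = size m by rewrite -[LHS]/(size q) size_map.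
exists q; split; last first.
  by apply: toC_inj; rewrite qE ofCK mz.
split; last split.
- rewrite /nonzero_polyQ list_lastE /q.
  have : last 0 m != 0 by rewrite -nth_last -lead_coefE lead_coef_eq0.
  case: (polyseq m) => [|x l] //=.
  rewrite (last_map (fun k : int => inject_Z (Z_of_int k))) /Qeq /= Z.mul_1_r.
  by move=> /eqP h /(congr1 int_of_Z); rewrite Z_of_intK.
- by apply: toC_inj; rewrite qE.
- move=> q' nq' q'0; apply/ssrnat.leP; rewrite szq.
  have [D [G [D0 hG sG /(_ nq') G0]]] := pevalQ_clear q'.
  apply: leq_trans sG; apply: mmin => //.
  by rewrite hG q'0 toC0 mulr0.
Qed.

Lemma algebraic_integer_monic (alpha : Cx) : algebraic_integer alpha ->
  exists P : {poly int}, P \is monic /\ ev P (toC alpha) = 0.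
Proof.
move=> [p [lp pa]].
have lp1 : last 1 (map int_of_Z p) = 1.
  case: p lp {pa} => [|x p] //; rewrite list_lastE /= => h.
  by rewrite (last_map int_of_Z) h.
exists (Poly (map int_of_Z p)); split.
  have lpn : last 1 (map int_of_Z p) != 0 by rewrite lp1.
  rewrite monicE lead_coefE nth_last (PolyK lpn).
  by case: p lp lp1 {lpn pa} => //= x p _ ->.
transitivity (toC (pevalZ p alpha)); last by rewrite pa.
rewrite /pevalZ toC_peval; congr (_.[_]); apply/polyP => i.
rewrite coef_map !coef_Poly /=.
elim: p i {lp pa lp1} => [|x p IH] [|i] //=; by rewrite toC_Z.
Qed.

(** Substituting the relation for the constant term leaves a combination of the four truncation
    errors. *)
Lemma relation_vanishing s (Q : nat -> {poly int}) (alpha F1 F2 F3 F4 : Cx) :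
  (forall i, odd (s i)) -> toC alpha != 0 ->
  f_sum s 1 (Cinv alpha) F1 -> f_sum s 2 (Cinv alpha) F2 ->
  f_sum s 3 (Cinv alpha) F3 -> f_sum s 4 (Cinv alpha) F4 ->
  ev (Q 4%N) (toC alpha) + (ev (Q 1%N) (toC alpha) * toC F1 +
    (ev (Q 2%N) (toC alpha) * toC F2 + (ev (Q 3%N) (toC alpha) * toC F3 +
      ev (Q 0%N) (toC alpha) * toC F4))) = 0 ->
  vanishing (fun n => (toC alpha)^-1 ^+ n * ev (Apoly s (Q 4%N) Q n) (toC alpha)).
Proof.
move=> s_odd a0 /f_sum_vanishing h1 /f_sum_vanishing h2 /f_sum_vanishing h3.
move=> /f_sum_vanishing h4 rel eta eta0.
have [n0 hn0] := vanishingD (vanishingD (vanishingZ (ev (Q 1%N) (toC alpha)) h1)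
  (vanishingZ (ev (Q 2%N) (toC alpha)) h2))
  (vanishingD (vanishingZ (ev (Q 3%N) (toC alpha)) h3)
  (vanishingZ (ev (Q 0%N) (toC alpha)) h4)) eta0.
exists n0.+1 => -[//|n] /hn0; rewrite ev_Apoly_scaled// !fpartialE toCV.
have -> : ev (Q 4%N) (toC alpha) = - (ev (Q 1%N) (toC alpha) * toC F1 +
    (ev (Q 2%N) (toC alpha) * toC F2 + (ev (Q 3%N) (toC alpha) * toC F3 +
      ev (Q 0%N) (toC alpha) * toC F4))) by apply/eqP; rewrite -addr_eq0 rel.
under [in X in _ -> X]eq_bigr do rewrite -sum_b// !mulrDl -!mulrA.
rewrite !big_split /= -!mulr_sumr.
congr (nm _ <= _); ring.
Qed.

End Bridge.

(** * Linear independence over the field generated by alpha *)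

Open Scope R_scope.

Theorem theorem1 (s : nat -> nat) (alpha F1 F2 F3 F4 : Cx) :
  standing_assumptions s ->
  algebraic_integer alpha ->
  1 < Cnorm alpha ->
  (forall z : Cx, conjugate_over_Q alpha z -> z <> alpha -> z <> Cconj alpha ->
     Cnorm z < 1) ->
  f_sum s 1 (Cinv alpha) F1 ->
  f_sum s 2 (Cinv alpha) F2 ->
  f_sum s 3 (Cinv alpha) F3 ->
  f_sum s 4 (Cinv alpha) F4 ->
  forall c0 c1 c2 c3 c4 : Cx,
    in_Qalpha alpha c0 -> in_Qalpha alpha c1 -> in_Qalpha alpha c2 ->
    in_Qalpha alpha c3 -> in_Qalpha alpha c4 ->
    Cadd (Cmul c0 Cx1)
      (Cadd (Cmul c1 F1) (Cadd (Cmul c2 F2) (Cadd (Cmul c3 F3) (Cmul c4 F4)))) = Cx0 ->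
    c0 = Cx0 /\ c1 = Cx0 /\ c2 = Cx0 /\ c3 = Cx0 /\ c4 = Cx0.
Proof.
move=> [s_inc [s_pos [s_cop [l s_cv]]]] alg a_gt1 a_conj h1 h2 h3 h4 c0 c1 c2 c3 c4.
move=> i0 i1 i2 i3 i4 rel.
have [P [Pm Pa]] := algebraic_integer_monic alg.
have [m [m_monic m_min]] := min_int_poly_monic Pm Pa.
(* Slots 0 to 3 follow the residue of [j] modulo 4, so [c4] comes first; the constant coefficient
   [c0] sits in slot 4. *)
pose c i := List.nth i [:: c4; c1; c2; c3; c0] c0.
have [|D [Q [D0 hQ]]] := @common_denominator alpha c 5.
  by case=> [|[|[|[|[|i]]]]].
have s_gt : forall i, (i < s i)%N.
  by apply: s_growth => //; apply/ssrnat.ltP; case: (s_pos 0%N).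
have s_odd i : odd (s i) by rewrite -nat_oddE; case: (s_pos i).
have a1 : (1 < ComplexField.Normc.normc (toC alpha))%R.
  by rewrite -Cnorm_normc; apply/RltP.
have a0 : toC alpha != 0%R.
  by apply: contraTneq a1 => ->; rewrite ComplexField.Normc.normc0 -leNgt ler01.
have lim : vanishing (fun n => (toC alpha)^-1 ^+ n *
    (map_poly (intr : int -> Rdefinitions.R[i]) (Apoly s (Q 4%N) Q n)).[toC alpha])%R.
  apply: (relation_vanishing s_odd a0 h1 h2 h3 h4).
  rewrite -!hQ// -!mulrA -!mulrDr -[RHS](mulr0 (map_poly intr D).[toC alpha]).
  by congr (_ * _)%R; rewrite -toC0 -rel !toCD !toCM toC1 mulr1.
have Q0 : forall j, (j < 4)%N ->
    (map_poly (intr : int -> Rdefinitions.R[i]) (Q j)).[toC alpha] = 0%R.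
  apply: (coef_eq0 s_gt s_odd _ _ a1 m_monic m_min _ lim).
  - by move=> i j ij; apply: nat_coprime; apply: s_cop; apply/eqP.
  - exact: tail_of_Un_cv s_cv.
  - move=> z mz; have := a_conj (ofC z) (conjugate_of_root m_min mz).
    have [->|na] := pselect (z = toC alpha); first by constructor 1.
    have [->|nb] := pselect (z = (toC alpha)^*%C); first by constructor 2.
    move=> H; constructor 3; rewrite -[z]ofCK -Cnorm_normc; apply/RltP/H.
      by move=> e; apply: na; rewrite -e ofCK.
    by move=> e; apply: nb; rewrite -[z]ofCK e.
have cz j : (j < 4)%N -> c j = Cx0.
  move=> j4; apply: toC_inj; rewrite toC0; apply: (mulfI D0).
  by rewrite hQ ?Q0 ?mulr0// (leq_trans j4).
have z1 : c1 = Cx0 by exact: (cz 1%N).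
have z2 : c2 = Cx0 by exact: (cz 2%N).
have z3 : c3 = Cx0 by exact: (cz 3%N).
have z4 : c4 = Cx0 by exact: (cz 0%N).
(* Once the other four coefficients vanish, the relation itself reduces to [c0 = Cx0]. *)
repeat split=> //; apply: toC_inj; move/(congr1 toC): rel.
by rewrite z1 z2 z3 z4 !toCD !toCM toC0 toC1 !mul0r !addr0 mulr1.
Qed.
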